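(* For $n=0,1,\ldots,\infty$ the space $\mathcal{E}_n$ is an $\mathcal{A}_n$-$\mathcal{B}_n$ pre-Morita equivalence bimodule. Moreover, if $B$ is unital, then for any state $\omega:B\to\mathbb{C}$ the image of $\mathcal{E}_n$ in $\mathfrak{h}_\omega$ is bounded in the seminorms $\|\cdot\|_{k,\omega}$ for $0\le k\le n$ (i.e. these seminorms are finite on the image).
   Context: Let $\mathfrak{A}\subset A$ and $\mathfrak{B}\subset B$ be dense $*$-subalgebras of $C^*$-algebras and $\mathfrak{E}$ an $\mathfrak{A}$-$\mathfrak{B}$ pre-Morita equivalence bimodule. Pre-Morita equivalence bimodule (for dense $*$-subalgebras $\mathcal{A}\subset A$, $\mathcal{B}\subset B$): an $\mathcal{A}$-$\mathcal{B}$-bimodule $\mathcal{E}$ with a right $\mathcal{B}$-valued inner product $(\cdot\mid\cdot)_{\mathcal{B}}$ (sesquilinear, linear in the second variable, $(e_1\mid e_2)_{\mathcal{B}}=(e_2\mid e_1)_{\mathcal{B}}^*$, $(e_1\mid e_2b)_{\mathcal{B}}=(e_1\mid e_2)_{\mathcal{B}}b$, $(e\mid e)_{\mathcal{B}}\ge0$ in $B$, and $=0$ only for $e=0$) and a left $\mathcal{A}$-valued inner product ${}_{\mathcal{A}}(\cdot\mid\cdot)$ (analogous, linear in the first variable), both full (the span of inner products is norm dense in $B$, resp. $A$), such that ${}_{\mathcal{A}}(eb\mid eb)\le\|b\|^2{}_{\mathcal{A}}(e\mid e)$, $(ae\mid ae)_{\mathcal{B}}\le\|a\|^2(e\mid e)_{\mathcal{B}}$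 and ${}_{\mathcal{A}}(e_1\mid e_2)e_3=e_1(e_2\mid e_3)_{\mathcal{B}}$, with $C^*$-norms and inequalities in $A$, $B$. Let $\{\partial_j^L\}_{j=1}^d:\mathfrak{A}\to\mathfrak{A}$ and $\{\partial_j^R\}_{j=1}^d:\mathfrak{B}\to\mathfrak{B}$ be families of commuting $*$-derivations (with the convention $\partial(a^* )=-\partial(a)^*$) and $\nabla_j:\mathfrak{E}\to\mathfrak{E}$, $j=1,\ldots,d$, a commuting family of operators with, for all $a\in\mathfrak{A}$, $b\in\mathfrak{B}$, $\xi,\eta\in\mathfrak{E}$, $$\nabla_j(a\xi b)=\partial_j^L(a)\xi b+a\nabla_j(\xi)b+a\xi\partial_j^R(b),\qquad \partial_j^R(\xi\mid\eta)_{\mathfrak{B}}=(\xi\mid\nabla_j\eta)_{\mathfrak{B}}-(\nabla_j\xi\mid\eta)_{\mathfrak{B}}.$$ For multi-indices $\alpha\in\mathbb{N}^d$ put $\|a\|_n=\sum_{|\alpha|\le n}\|\partial^\alpha a\|/\alpha!$ on $\mathfrak{A}$ (with $\partial=\partial^L$) and on $\mathfrak{B}$ (with $\partial=\partial^R$), where $\|\cdot\|$ is the $C^*$-norm, and $\|e\|_n=\sum_{|\alpha|\le n}\|\nabla^\alpha e\|/\alpha!$ on $\mathfrak{E}$, where $\|e\|=\|(e\mid e)_{\mathfrak{B}}\|^{1/2}$. $\mathcal{A}_n,\mathcal{B}_n,\mathcal{E}_n$ denote the completions of $\mathfrak{A},\mathfrak{B},\mathfrak{E}$ in the seminorms $\|\cdot\|_k$,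 $k\le n$ (all $k$ for $n=\infty$); $\mathcal{A}_n$ and $\mathcal{B}_n$ are regarded as dense $*$-subalgebras of $A$ and $B$, and $\mathcal{E}_n$ as a subspace of the $C^*$-module closure $E$ of $\mathfrak{E}$. For a state $\omega$ on unital $B$, $\mathfrak{h}_\omega$ is the Hilbert space completion of $E$ in $\langle e_1,e_2\rangle_\omega=\omega((e_1\mid e_2)_B)$, and $\|\xi\|_{k,\omega}=\sum_{|\alpha|\le k}\|\nabla^\alpha\xi\|_{\mathfrak{h}_\omega}/\alpha!$. *)

(* Defs.v *)
(* The complex numbers are R[i] for R : realType;
   the norm of a normedModType over R[i] takes values in R[i] (nonnegative,
   hence real, complex numbers), ordered by the partial order of R[i]. *)
From HB Require Import structures.
From mathcomp Require Import all_boot all_order all_algebra.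
From mathcomp Require Export complex.
From mathcomp Require Import all_classical all_reals all_analysis.

Set Implicit Arguments.
Unset Strict Implicit.
Unset Printing Implicit Defensive.

Import Order.TTheory GRing.Theory Num.Theory.
Import numFieldNormedType.Exports.

Local Open Scope classical_set_scope.
Local Open Scope ring_scope.
Local Open Scope complex_scope.

(** * C*-algebras (not necessarily unital, so not a MathComp ring) *)

HB.mixin Record isCStarAlgebra (R : realType) A
    of CompleteNormedModule R[i] A := {
  cmul : A -> A -> A;
  adj : A -> A;
  cmulA : forall a b c : A, cmul a (cmul b c) = cmul (cmul a b) c;
  cmulDl : forall a b c : A, cmul (a + b) c = cmul a c + cmul b c;
  cmulDr : forall a b c : A, cmul a (b + c) = cmul a b + cmul a c;
  cmulZl : forall (z : R[i]) (a b : A), cmul (z *: a) b = z *: cmul a b;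
  cmulZr : forall (z : R[i]) (a b : A), cmul a (z *: b) = z *: cmul a b;
  adjK : forall a : A, adj (adj a) = a;
  adjD : forall a b : A, adj (a + b) = adj a + adj b;
  adjZ : forall (z : R[i]) (a : A), adj (z *: a) = (Num.conj z) *: adj a;
  adjM : forall a b : A, adj (cmul a b) = cmul (adj b) (adj a);
  normcM_le : forall a b : A, `|cmul a b| <= `|a| * `|b|;
  cstar_norm : forall a : A, `|cmul (adj a) a| = `|a| ^+ 2
}.

#[short(type="cstarAlgType")]
HB.structure Definition CStarAlgebra (R : realType) :=
  { A of isCStarAlgebra R A & CompleteNormedModule R[i] A }.

Section CStar.
Context {R : realType} {A : cstarAlgType R}.
Implicit Types (a b : A) (S : set A).

Definition cpos a : Prop := exists c : A, a = cmul (adj c) c.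

Definition cle a b : Prop := cpos (b - a).

Definition is_unit_elt (e : A) : Prop := forall a, cmul e a = a /\ cmul a e = a.

Record is_state (e : A) (omega : A -> R[i]) : Prop := {
  stateD : forall a b, omega (a + b) = omega a + omega b;
  stateZ : forall (z : R[i]) a, omega (z *: a) = z * omega a;
  state_pos : forall a, cpos a -> 0 <= omega a;
  state1 : omega e = 1
}.

End CStar.

(** * Subspaces and spans *)

Section Subspaces.
Context {K : numFieldType}.

Definition subspace (V : lmodType K) (S : set V) : Prop :=
  S 0 /\ forall (z : K) x y, S x -> S y -> S (z *: x + y).

Definition linear_on (V : lmodType K) (S : set V) (f : V -> V) : Prop :=
  forall (z : K) x y, S x -> S y -> f (z *: x + y) = z *: f x + f y.

Definition lspan (V : lmodType K) (S : set V) : set V :=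
  [set v | exists m (c : 'I_m -> K) (s : 'I_m -> V),
     (forall i, S (s i)) /\ v = \sum_(i < m) c i *: s i].

End Subspaces.

Record dense_star_subalgebra (R : realType) (A : cstarAlgType R) (S : set A)
    : Prop := {
  dss_subspace : subspace S;
  dss_mul : forall a b, S a -> S b -> S (cmul a b);
  dss_adj : forall a, S a -> S (adj a);
  dss_dense : dense S
}.

(** * Inner product bimodules

   Subalgebras and submodules are sets in an ambient space.  Actions and inner
   products are total functions, constrained only on those sets: [X] is a
   subspace of [E], [SA] a subalgebra of [A], [SB] a subalgebra of [B]. *)

Section Bimodules.
Context {R : realType} {A B : cstarAlgType R} {E : lmodType R[i]}.

Record right_inner_module (SB : set B) (X : set E)
    (ract : E -> B -> E) (rip : E -> E -> B) : Prop := {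
  rim_subspace : subspace X;
  ract_in : forall e b, X e -> SB b -> X (ract e b);
  ractDl : forall e f b, X e -> X f -> SB b ->
    ract (e + f) b = ract e b + ract f b;
  ractDr : forall e b c, X e -> SB b -> SB c ->
    ract e (b + c) = ract e b + ract e c;
  ractZl : forall (z : R[i]) e b, X e -> SB b -> ract (z *: e) b = z *: ract e b;
  ractZr : forall (z : R[i]) e b, X e -> SB b -> ract e (z *: b) = z *: ract e b;
  ractM : forall e b c, X e -> SB b -> SB c ->
    ract e (cmul b c) = ract (ract e b) c;
  rip_in : forall e f, X e -> X f -> SB (rip e f);
  ripDr : forall e f g, X e -> X f -> X g -> rip e (f + g) = rip e f + rip e g;
  ripZr : forall (z : R[i]) e f, X e -> X f -> rip e (z *: f) = z *: rip e f;
  rip_adj : forall e f, X e -> X f -> rip e f = adj (rip f e);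
  rip_act : forall e f b, X e -> X f -> SB b ->
    rip e (ract f b) = cmul (rip e f) b;
  rip_pos : forall e, X e -> cpos (rip e e);
  rip_def : forall e, X e -> rip e e = 0 -> e = 0
}.

Record left_inner_module (SA : set A) (X : set E)
    (lact : A -> E -> E) (lip : E -> E -> A) : Prop := {
  lim_subspace : subspace X;
  lact_in : forall a e, SA a -> X e -> X (lact a e);
  lactDl : forall a b e, SA a -> SA b -> X e ->
    lact (a + b) e = lact a e + lact b e;
  lactDr : forall a e f, SA a -> X e -> X f ->
    lact a (e + f) = lact a e + lact a f;
  lactZl : forall (z : R[i]) a e, SA a -> X e -> lact (z *: a) e = z *: lact a e;
  lactZr : forall (z : R[i]) a e, SA a -> X e -> lact a (z *: e) = z *: lact a e;
  lactM : forall a b e, SA a -> SA b -> X e ->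
    lact (cmul a b) e = lact a (lact b e);
  lip_in : forall e f, X e -> X f -> SA (lip e f);
  lipDl : forall e f g, X e -> X f -> X g -> lip (e + f) g = lip e g + lip f g;
  lipZl : forall (z : R[i]) e f, X e -> X f -> lip (z *: e) f = z *: lip e f;
  lip_adj : forall e f, X e -> X f -> lip e f = adj (lip f e);
  lip_act : forall a e f, SA a -> X e -> X f ->
    lip (lact a e) f = cmul a (lip e f);
  lip_pos : forall e, X e -> cpos (lip e e);
  lip_def : forall e, X e -> lip e e = 0 -> e = 0
}.

Record pre_morita (SA : set A) (SB : set B) (X : set E)
    (lact : A -> E -> E) (ract : E -> B -> E)
    (lip : E -> E -> A) (rip : E -> E -> B) : Prop := {
  pm_subalgA : dense_star_subalgebra SA;
  pm_subalgB : dense_star_subalgebra SB;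
  pm_left : left_inner_module SA X lact lip;
  pm_right : right_inner_module SB X ract rip;
  pm_assoc : forall a e b, SA a -> X e -> SB b ->
    ract (lact a e) b = lact a (ract e b);
  pm_full_left : dense (lspan [set a | exists e f, [/\ X e, X f & a = lip e f]]);
  pm_full_right : dense (lspan [set b | exists e f, [/\ X e, X f & b = rip e f]]);
  pm_bound_left : forall e b, X e -> SB b ->
    cle (lip (ract e b) (ract e b)) (`|b| ^+ 2 *: lip e e);
  pm_bound_right : forall a e, SA a -> X e ->
    cle (rip (lact a e) (lact a e)) (`|a| ^+ 2 *: rip e e);
  pm_compat : forall e f g, X e -> X f -> X g ->
    lact (lip e f) g = ract e (rip f g)
}.

End Bimodules.

(* A Hilbert C*-module: complete (by its type) for |e| = |(e|e)_B|^{1/2}. *)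
Definition hilbert_module (R : realType) (B : cstarAlgType R)
    (E : completeNormedModType R[i])
    (ract : E -> B -> E) (rip : E -> E -> B) : Prop :=
  right_inner_module setT setT ract rip /\
  forall e : E, `|e| ^+ 2 = `|rip e e|.

(** * Derivations and connections *)

Record commuting_star_derivations (R : realType) (A : cstarAlgType R) (d : nat)
    (S : set A) (D : 'I_d -> A -> A) : Prop := {
  der_in : forall j a, S a -> S (D j a);
  der_linear : forall j, linear_on S (D j);
  der_leibniz : forall j a b, S a -> S b ->
    D j (cmul a b) = cmul (D j a) b + cmul a (D j b);
  der_adj : forall j a, S a -> D j (adj a) = - adj (D j a);
  der_comm : forall j k a, S a -> D j (D k a) = D k (D j a)
}.

Record commuting_connections (R : realType) (A B : cstarAlgType R)
    (E : lmodType R[i]) (d : nat) (SA : set A) (SB : set B) (X : set E)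
    (lact : A -> E -> E) (ract : E -> B -> E) (rip : E -> E -> B)
    (DL : 'I_d -> A -> A) (DR : 'I_d -> B -> B) (nabla : 'I_d -> E -> E)
    : Prop := {
  conn_in : forall j e, X e -> X (nabla j e);
  conn_linear : forall j, linear_on X (nabla j);
  conn_comm : forall j k e, X e -> nabla j (nabla k e) = nabla k (nabla j e);
  conn_leibniz : forall j a e b, SA a -> X e -> SB b ->
    nabla j (ract (lact a e) b) =
      ract (lact (DL j a) e) b + ract (lact a (nabla j e)) b
      + ract (lact a e) (DR j b);
  conn_metric : forall j e f, X e -> X f ->
    DR j (rip e f) = rip e (nabla j f) - rip (nabla j e) f
}.

(** * The seminorms and completions

   The smoothness order n = 0, 1, ..., oo is an [option nat], [None] being oo.
   Multi-indices of length at most k are functions 'I_d -> {0, ..., k}. *)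

Definition le_order (k : nat) (n : option nat) : bool :=
  if n is Some m then (k <= m)%N else true.

Definition msize (d k : nat) (alpha : {ffun 'I_d -> 'I_k.+1}) : nat :=
  (\sum_(i < d) alpha i)%N.

Definition mfact (d k : nat) (alpha : {ffun 'I_d -> 'I_k.+1}) : nat :=
  (\prod_(i < d) (alpha i)`!)%N.

(* D^alpha = D_0^(alpha_0) o ... o D_(d-1)^(alpha_(d-1)) *)
Definition mpower (d k : nat) (V : Type) (D : 'I_d -> V -> V)
    (alpha : {ffun 'I_d -> 'I_k.+1}) (x : V) : V :=
  foldr (fun i y => iter (alpha i) (D i) y) x (enum 'I_d).

Section Completion.
Context {R : realType} {V : normedModType R[i]} {d : nat}.
Variables (S : set V) (D : 'I_d -> V -> V).

Definition seminorm (k : nat) (x : V) : R[i] :=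
  \sum_(alpha : {ffun 'I_d -> 'I_k.+1} | (msize alpha <= k)%N)
    `|mpower D alpha x| / (mfact alpha)%:R.

Definition seminorm_cauchy (n : option nat) (u : nat -> V) : Prop :=
  forall k, le_order k n -> forall eps : R[i], 0 < eps ->
    exists N, forall p q, (N <= p)%N -> (N <= q)%N ->
      seminorm k (u p - u q) < eps.

(* [u] represents an element of the completion of [S], whose image in the
   ambient Banach space [V] is [x]. *)
Definition represents (n : option nat) (u : nat -> V) (x : V) : Prop :=
  [/\ forall i, S (u i), seminorm_cauchy n u & u @ \oo --> x].

(* The completion of [S] regarded as a subspace of [V]: the image of the
   canonical map sending the class of a Cauchy sequence to its limit in [V]. *)
Definition completion (n : option nat) : set V :=
  [set x | exists u, represents n u x].

End Completion.

(** * The Hilbert space of a state *)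

Record inner_product (R : realType) (H : normedModType R[i])
    (ip : H -> H -> R[i]) : Prop := {
  ipDr : forall x y z, ip x (y + z) = ip x y + ip x z;
  ipZr : forall (c : R[i]) x y, ip x (c *: y) = c * ip x y;
  ip_conj : forall x y, ip x y = Num.conj (ip y x);
  ip_norm : forall x, `|x| ^+ 2 = ip x x
}.

(* [H] with [j : E -> H] is the Hilbert space completion of [E] (modulo null
   vectors) for <e, f> = omega ((e|f)_B); the completion is unique up to a
   unitary compatible with [j]. *)
Record state_completion (R : realType) (B : cstarAlgType R) (E : lmodType R[i])
    (rip : E -> E -> B) (omega : B -> R[i])
    (H : completeNormedModType R[i]) (ip : H -> H -> R[i]) (j : E -> H)
    : Prop := {
  sc_ip : inner_product ip;
  sc_linear : forall (z : R[i]) e f, j (z *: e + f) = z *: j e + j f;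
  sc_inner : forall e f, ip (j e) (j f) = omega (rip e f);
  sc_dense : dense (range j)
}.

(* ||xi||_{k,omega} for the element xi of the completion represented by [u].
   nabla^alpha xi is the limit of nabla^alpha (u i) in E (extension of
   nabla^alpha by continuity); a term for which it does not exist is +oo. *)
Definition state_seminorm (R : realType) (E H : completeNormedModType R[i])
    (d : nat) (nabla : 'I_d -> E -> E) (j : E -> H) (k : nat) (u : nat -> E)
    : \bar R :=
  (\sum_(alpha : {ffun 'I_d -> 'I_k.+1} | (msize alpha <= k)%N)
    (if `[< cvgn (fun i => mpower nabla alpha (u i)) >]
     then (complex.Re `|j (limn (fun i => mpower nabla alpha (u i)))|
             / (mfact alpha)%:R)%:E
     else +oo))%E.

(* Main.v *)
Require Import Defs.
From HB Require Import structures.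
From mathcomp Require Import all_boot all_order all_algebra.
From mathcomp Require Import ring lra zify.
From mathcomp Require Import all_classical all_reals all_analysis.
Import Order.TTheory GRing.Theory Num.Theory.
Import numFieldNormedType.Exports.
Import Defs.
Set Implicit Arguments.
Unset Strict Implicit.
Unset Printing Implicit Defensive.
Local Open Scope classical_set_scope.
Local Open Scope ring_scope.
Local Open Scope complex_scope.

(** The completions are handled in two independent steps.

Analytically, the dense bimodule X extends to a Morita context on the whole of
A, B and E.  The left action is bounded because (ae|ae) <= |a|^2 (e|e), and the left
inner product is bounded because its norm is comparable with the norm of E
([lip_bounded]).  So both extend by continuity, and every identity extends by density
([total_morita]).  Two facts about C*-algebras carry this step: the norm is monotone
on positive elements ([cle_rnorm]), and the set of elements c^* c is closed
([cpos_closed]).  The latter says that a limit of elements c_i^* c_i is again of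
this form, which depends on the theorem that c^* c is positive ([npos_star]).  These
facts are proved in the unitization, without spectral theory: positivity of a
self-adjoint h means |t - h| <= t for some t, square roots are limits of the
iteration y |-> (w + y^2) / 2, and norm estimates come from writing elements as real parts
of normal elements u with u^* u scalar.

Algebraically, an element of the completion of order n is the limit of a sequence
whose derivatives of order at most n all converge ([seminorm_cauchyP]).  By
induction on the order, this property is preserved by every continuous operation
that satisfies a Leibniz rule ([completion_leibniz]); so the completions are closed under all
operations, and the Morita context on A, B and E restricts to them
([pre_morita_restrict]).  The Leibniz rules for a e, for e b and for the left inner product
are consequences of the rule for a e b and of the metric property on the right,
because the actions are faithful ([nabla_lact], [nabla_ract], [DL_lip]).

The last claim holds because the derivatives of a representing sequence converge
in E ([state_seminorm_lty]). *)

(** * Positivity in unital C*-algebras *)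

(** A unital C*-algebra over the complex numbers, seen as an algebra over [R]
together with the central element [ii] that plays the role of the imaginary
unit.  Only real scalars occur below, so that all estimates are inequalities in
[R]. *)
Record unital_cstar (R : realType) (U : algType R) (star : U -> U)
    (nrm : U -> R) (ii : U) : Prop := {
  ustarD : forall x y, star (x + y) = star x + star y;
  ustarZ : forall (t : R) x, star (t *: x) = t *: star x;
  ustarM : forall x y, star (x * y) = star y * star x;
  ustarK : forall x, star (star x) = x;
  unormD : forall x y, nrm (x + y) <= nrm x + nrm y;
  unormZ : forall (t : R) x, nrm (t *: x) = `|t| * nrm x;
  unorm_eq0 : forall x, nrm x = 0 -> x = 0;
  unormM : forall x y, nrm (x * y) <= nrm x * nrm y;
  unorm_star : forall x, nrm (star x * x) = nrm x ^+ 2;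
  iiC : forall x, x * ii = ii * x;
  ii2 : ii * ii = -1;
  star_ii : star ii = - ii;
  ucomplete : forall u : nat -> U,
    (forall eps, 0 < eps -> exists N, forall p q, (N <= p)%N -> (N <= q)%N ->
       nrm (u p - u q) < eps) ->
    exists l, forall eps, 0 < eps -> exists N, forall p, (N <= p)%N ->
       nrm (u p - l) < eps
}.

Section UnitalCStar.
Context {R : realType} {U : algType R} {star : U -> U} {nrm : U -> R} {ii : U}.
Hypothesis HU : unital_cstar star nrm ii.
Implicit Types (x y h w : U) (t : R).

Lemma half_double x : 2^-1 *: (x + x) = x.
Proof. by rewrite -[x in x + x]scale1r -scalerDl scalerA mulVf ?scale1r //; lra. Qed.

Lemma ustar0 : star 0 = 0.
Proof. by rewrite -(scale0r (0 : U)) (ustarZ HU) !scale0r. Qed.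

Lemma ustarN x : star (- x) = - star x.
Proof. by rewrite -scaleN1r (ustarZ HU) scaleN1r. Qed.

Lemma ustarB x y : star (x - y) = star x - star y.
Proof. by rewrite (ustarD HU) ustarN. Qed.

Lemma ustar1 : star 1 = 1.
Proof. by have := ustarM HU (star 1) 1; rewrite mulr1 (ustarK HU) mulr1 => {2}->. Qed.

Lemma ustarA t : star t%:A = t%:A.
Proof. by rewrite (ustarZ HU) ustar1. Qed.

Lemma unorm0 : nrm 0 = 0.
Proof. by rewrite -(scale0r (0 : U)) (unormZ HU) normr0 mul0r. Qed.

Lemma unormN x : nrm (- x) = nrm x.
Proof. by rewrite -scaleN1r (unormZ HU) normrN1 mul1r. Qed.

Lemma unorm_ge0 x : 0 <= nrm x.
Proof. have := unormD HU x (- x); rewrite subrr unorm0 unormN; lra. Qed.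

Lemma unormC x y : nrm (x - y) = nrm (y - x).
Proof. by rewrite -unormN opprB. Qed.

Lemma unormB x y : nrm (x - y) <= nrm x + nrm y.
Proof. by rewrite -(unormN y) (unormD HU). Qed.

Lemma unorm_adj x : nrm (star x) = nrm x.
Proof.
have le_adj y : nrm y <= nrm (star y).
  have [/eqP y0|y0] := boolP (nrm y == 0); first by rewrite y0 unorm_ge0.
  have y1 : 0 < nrm y by rewrite lt_neqAle eq_sym y0 unorm_ge0.
  by rewrite -(ler_pM2r y1) -expr2 -(unorm_star HU) (unormM HU).
by apply/le_anti; rewrite le_adj -{2}(ustarK HU x) le_adj.
Qed.

Lemma unorm1 : nrm 1 = 1.
Proof.
have n1 : nrm 1 != 0.
  by apply/eqP => /(unorm_eq0 HU) /eqP; rewrite oner_eq0.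
have := unorm_star HU 1; rewrite ustar1 mul1r expr2 => h.
by apply: (mulfI n1); rewrite mulr1 -h.
Qed.

Lemma unormA t : nrm t%:A = `|t|.
Proof. by rewrite (unormZ HU) unorm1 mulr1. Qed.

Lemma unorm_sa k : star k = k -> nrm (k * k) = nrm k ^+ 2.
Proof. by move=> {1}<-; rewrite (unorm_star HU). Qed.

Lemma unorm_le0 x : (forall e, 0 < e -> nrm x <= e) -> x = 0.
Proof.
move=> h; apply: (unorm_eq0 HU); apply/le_anti; rewrite unorm_ge0 andbT.
by apply/ler_addgt0Pl => e e0; rewrite addr0 h.
Qed.

Lemma sa_sq_eq0 k : star k = k -> k * k = 0 -> k = 0.
Proof.
move=> sk k0; apply: (unorm_eq0 HU); apply/eqP; rewrite -sqrf_eq0.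
by rewrite -unorm_sa // k0 unorm0.
Qed.

(** The iteration y |-> (w + y^2) / 2 started at 0.  A fixed point y satisfies
(1 - y)^2 = 1 - w, so this computes 1 - sqrt(1 - w) without power series.  All
iterates are polynomials in [w] with nonnegative coefficients and so are their
successive differences: the scalar iteration with w = 1 dominates them. *)
Fixpoint root_iter (V : algType R) (w : V) (n : nat) : V :=
  if n is m.+1 then 2^-1 *: (w + root_iter w m * root_iter w m) else 0.

Lemma root_iterS (V : algType R) (w : V) n :
  root_iter w n.+1 = 2^-1 *: (w + root_iter w n * root_iter w n).
Proof. by []. Qed.

Let rho n := root_iter (1 : R^o) n : R.

Lemma root_iter_real n : [/\ 0 <= rho n, rho n <= 1 & rho n <= rho n.+1].
Proof.
elim: n => [|n [r0 r1 rS]].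
  by rewrite /rho /= mulr0 addr0 /GRing.scale /= mulr1; split; lra.
have E m : rho m.+1 = (1 + rho m ^+ 2) / 2 by rewrite /rho /= /GRing.scale /= -expr2 mulrC.
rewrite (E n.+1) (E n); rewrite E in rS.
split; [nra|nra|].
by move: (rho n) r0 r1 rS => s *; nra.
Qed.

Lemma root_iter_norm w n : nrm w <= 1 -> nrm (root_iter w n) <= rho n.
Proof.
move=> w1; elim: n => [|n IH]; first by rewrite unorm0.
rewrite /rho /= (unormZ HU) ger0_norm; last lra.
rewrite /GRing.scale /= ler_pM2l; last lra.
apply: (le_trans (unormD HU _ _)); apply: lerD => //.
apply: (le_trans (unormM HU _ _)).
by apply: ler_pM => //; apply: unorm_ge0.
Qed.

(** Induction on the identity b^2 - a^2 = b (b - a) + (b - a) a, valid without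
commutativity, for consecutive iterates a and b. *)
Lemma root_iter_incr w n : nrm w <= 1 ->
  nrm (root_iter w n.+1 - root_iter w n) <= rho n.+1 - rho n.
Proof.
move=> w1; elim: n => [|n IH].
  by have := root_iter_norm 1 w1; rewrite /rho /= !subr0.
have -> : root_iter w n.+2 - root_iter w n.+1 =
   2^-1 *: (root_iter w n.+1 * (root_iter w n.+1 - root_iter w n)
         + (root_iter w n.+1 - root_iter w n) * root_iter w n).
  rewrite (root_iterS w n.+1) {2}(root_iterS w n) -scalerBr opprD addrACA subrr.
  by rewrite add0r mulrBr mulrBl addrA subrK.
have -> : rho n.+2 - rho n.+1 =
   2^-1 * (rho n.+1 * (rho n.+1 - rho n) + (rho n.+1 - rho n) * rho n).
  by rewrite /rho /= /GRing.scale /=; field.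
rewrite (unormZ HU) ger0_norm; last lra.
rewrite ler_pM2l; last lra.
apply: (le_trans (unormD HU _ _)); apply: lerD;
  apply: (le_trans (unormM HU _ _)); apply: ler_pM => //;
  solve [exact: unorm_ge0 | exact: root_iter_norm].
Qed.

Lemma root_iter_dist w m n : nrm w <= 1 ->
  nrm (root_iter w (m + n)%N - root_iter w n) <= rho (m + n)%N - rho n.
Proof.
move=> w1; elim: m => [|m IH]; first by rewrite !subrr unorm0.
rewrite addSn -(subrK (root_iter w (m + n)) (root_iter w (m + n).+1)) -addrA.
apply: (le_trans (unormD HU _ _)).
have := root_iter_incr (m + n) w1; lra.
Qed.

Lemma root_iter_cauchy w : nrm w <= 1 ->
  forall eps, 0 < eps -> exists N, forall p q, (N <= p)%N -> (N <= q)%N ->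
       nrm (root_iter w p - root_iter w q) < eps.
Proof.
move=> w1 eps e0.
have rC : cvgn (rho : R^nat).
  apply: nondecreasing_is_cvgn.
    by apply/nondecreasing_seqP => n; have [] := root_iter_real n.
  by exists 1 => _ [n _ <-]; have [] := root_iter_real n.
have /cvgrPdist_lt /(_ (eps / 2)) := rC.
case; first by lra.
move=> N _ hN; exists N.
have key p q : (N <= q)%N -> (q <= p)%N -> nrm (root_iter w p - root_iter w q) < eps.
  move=> Nq qp; have := root_iter_dist (p - q) q w1; rewrite subnK // => H.
  apply: le_lt_trans H _.
  have /= := hN q Nq; have /= := hN p (leq_trans Nq qp).
  by rewrite !ltr_norml => /andP[? ?] /andP[? ?]; lra.
move=> p q Np Nq; have [qp|/ltnW pq] := leqP q p; first exact: key.
by rewrite unormC; apply: key.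
Qed.

(** The limit of the iteration; self-adjointness and the bicommutant property
pass from the iterates to the limit. *)
Lemma unorm_root w : nrm w <= 1 -> exists y,
  [/\ nrm y <= 1, 2 *: y = w + y * y, star w = w -> star y = y
    & forall x, GRing.comm x w -> GRing.comm x y].
Proof.
move=> w1; have [y hy] := ucomplete HU (root_iter_cauchy w1).
set v := root_iter w in hy.
have v1 n : nrm (v n) <= 1.
  by apply: le_trans (root_iter_norm n w1) _; have [] := root_iter_real n.
have y1 : nrm y <= 1.
  apply/ler_addgt0Pl => e e0; have [N /(_ _ (leqnn N))] := hy e e0.
  rewrite unormC => hN; rewrite -(subrK (v N) y).
  by apply: le_trans (unormD HU _ _) _; apply: lerD (v1 _); apply: ltW.
exists y; split => //.
- apply/eqP; rewrite -subr_eq0; apply/eqP/unorm_le0 => e e0.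
  have [|N hN] := hy (e / 4); first by lra.
  have a1 := hN _ (leqnn N); have a2 := hN _ (leqnSn N).
  have -> : 2 *: y - (w + y * y) = (2 : R) *: (y - v N.+1)
      + (v N * (v N - y) + (v N - y) * y).
    have -> : v N.+1 = 2^-1 *: (w + v N * v N) by [].
    rewrite scalerBr scalerA divff ?scale1r; last by lra.
    have -> : v N * (v N - y) + (v N - y) * y = v N * v N - y * y.
      by rewrite mulrBr mulrBl addrA subrK.
    by rewrite -[RHS]addrA !opprD addrA -!addrA; congr (_ + (_ + _)); rewrite addKr.
  apply: (le_trans (unormD HU _ _)); rewrite (unormZ HU) ger0_norm; last lra.
  rewrite unormC.
  have b1 : nrm (v N * (v N - y) + (v N - y) * y) <= nrm (v N - y) + nrm (v N - y).
    apply: le_trans (unormD HU _ _) _; apply: lerD; apply: le_trans (unormM HU _ _) _.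
      by rewrite -[leRHS]mul1r ler_wpM2r ?unorm_ge0.
    by rewrite -[leRHS]mulr1 ler_wpM2l ?unorm_ge0.
  lra.
- move=> sw.
  have sv n : star (v n) = v n.
    elim: n => [|n IH]; first exact: ustar0.
    have -> : v n.+1 = 2^-1 *: (w + v n * v n) by [].
    by rewrite (ustarZ HU) (ustarD HU) (ustarM HU) IH sw.
  apply/eqP; rewrite -subr_eq0; apply/eqP/unorm_le0 => e e0.
  have [|N /(_ _ (leqnn N)) hN] := hy (e / 2); first by lra.
  rewrite -(subrK (v N) (star y)) -addrA.
  apply: le_trans (unormD HU _ _) _.
  by rewrite -{1}(sv N) -ustarB unorm_adj unormC; lra.
- move=> x xw.
  have xv n : GRing.comm x (v n).
    elim: n => [|n IH]; first exact: commr0.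
    have -> : v n.+1 = 2^-1 *: (w + v n * v n) by [].
    rewrite /GRing.comm -scalerAr -scalerAl; congr (_ *: _).
    by apply: commrD => //; apply: commrM.
  apply/eqP; rewrite -subr_eq0; apply/eqP/unorm_le0 => e e0.
  have [|N /(_ _ (leqnn N)) hN] := hy (e / (2 * (nrm x + 1))).
    by have := unorm_ge0 x => ?; apply: divr_gt0 => //; nra.
  have -> : x * y - y * x = (v N - y) * x - x * (v N - y).
    by rewrite mulrBr mulrBl -(xv N) opprB [RHS]addrC addrA subrK.
  apply: le_trans (unormB _ _) _.
  have h1 := unormM HU (v N - y) x; have h2 := unormM HU x (v N - y).
  have x0 := unorm_ge0 x.
  move: hN; rewrite ltr_pdivlMr; last by nra.
  have := unorm_ge0 (v N - y).
  by move: h1 h2; move: (nrm _) (nrm (x * _)) (nrm x) x0 (nrm _) => a b c c0 d *; nra.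
Qed.

(** Positivity read off the norm: for self-adjoint [h] it says that the spectrum
lies in [0, 2t].  Unlike being of the form c^* c, this condition is stable under
sums by the triangle inequality, and under limits once t is normalized to the norm
of [h] ([npos_norm]). *)
Definition npos h : Prop := star h = h /\ exists t, nrm (t%:A - h) <= t.

(** Write h = T (1 - w) with |w| <= 1 and use the square root of 1 - w; the bound t
is enlarged to T = t + 1 only to make it invertible. *)
Lemma npos_sqrt h : npos h -> exists k,
  [/\ star k = k, npos k, k * k = h & forall x, GRing.comm x h -> GRing.comm x k].
Proof.
move=> [sh [t ht]].
have t0 : 0 <= t := le_trans (unorm_ge0 _) ht.
pose T := t + 1; have T0 : 0 < T by rewrite /T; lra.
pose w := 1 - T^-1 *: h.
have w1 : nrm w <= 1.
  have -> : w = T^-1 *: (1 + (t%:A - h)).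
    rewrite addrA (addrC 1) -{2}(scale1r (1 : U)) -scalerDl -/T.
    by rewrite scalerBr scalerA mulVf ?gt_eqF // scale1r.
  rewrite (unormZ HU) gtr0_norm ?invr_gt0 // ler_pdivrMl // mulr1.
  by apply: le_trans (unormD HU _ _) _; rewrite unorm1 /T; lra.
have sw : star w = w by rewrite ustarB ustar1 (ustarZ HU) sh.
have [y [y1 yw sy cy]] := unorm_root w1.
pose s := Num.sqrt T; have ss : s * s = T by rewrite -expr2 sqr_sqrtr // ltW.
exists (s *: (1 - y)); split.
- by rewrite (ustarZ HU) ustarB ustar1 sy.
- split; first by rewrite (ustarZ HU) ustarB ustar1 sy.
  exists s; rewrite -scalerBr opprB addrC subrK (unormZ HU).
  by rewrite ger0_norm ?sqrtr_ge0 // -[leRHS]mulr1 ler_wpM2l ?sqrtr_ge0.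
- rewrite -scalerAl -scalerAr scalerA ss mulrBr mulr1 mulrBl mul1r.
  have -> : 1 - y - (y - y * y) = 1 - w.
    have -> : w = 2 *: y - y * y by rewrite yw addrK.
    by rewrite scaler_nat mulr2n !opprB -!addrA; congr (_ + _);
      rewrite addrCA -opprD.
  by rewrite /w opprB addrC subrK scalerA divff ?scale1r // gt_eqF.
- move=> x xh; rewrite /GRing.comm -scalerAr -scalerAl; congr (_ *: _).
  apply: commrB; first exact: commr1.
  apply: cy; apply: commrB; first exact: commr1.
  by rewrite /GRing.comm -scalerAr -scalerAl xh.
Qed.

(** The element u = a + i b is normal with u^* u = t, hence |u|^2 = |t|, and [a] is
its real part. *)
Lemma unorm_pyth a b t : star a = a -> star b = b -> GRing.comm a b ->
  a * a + b * b = t%:A -> nrm a ^+ 2 <= `|t|.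
Proof.
move=> sa sb ab abt.
pose u := a + ii * b.
have su : star u = a - ii * b.
  by rewrite (ustarD HU) (ustarM HU) sa sb (star_ii HU) mulrN (iiC HU).
have suu : star u * u = t%:A.
  have E1 : a * (ii * b) = ii * b * a by rewrite mulrA (iiC HU) -mulrA ab mulrA.
  have E2 : ii * b * (ii * b) = - (b * b).
    by rewrite mulrA (iiC HU (ii * b)) mulrA (ii2 HU) mulN1r mulNr.
  by rewrite su -abt mulrDr !mulrBl E1 E2 opprK addrA subrK.
have nu : nrm u ^+ 2 = `|t| by rewrite -(unorm_star HU) suu unormA.
have na : nrm a <= nrm u.
  have -> : a = 2^-1 *: (u + star u).
    by rewrite su addrACA subrr addr0 half_double.
  rewrite (unormZ HU) ger0_norm; last lra.
  by have := unormD HU u (star u); rewrite unorm_adj; lra.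
by rewrite -nu; apply: lerXn2r; rewrite ?nnegrE ?unorm_ge0.
Qed.

(** With s the square root of 1 - k^2 / t, the pair k, sqrt(t) s satisfies the
hypotheses of the previous lemma; this bounds t s^2 = t - k^2. *)
Lemma npos_sq_norm k t : star k = k -> nrm k ^+ 2 <= t -> nrm (t%:A - k * k) <= t.
Proof.
move=> sk kt.
have [t0|t0] := leP t 0.
  have k0 : k = 0.
    by apply: (unorm_eq0 HU); have := unorm_ge0 k => ?; nra.
  by move: kt; rewrite k0 mulr0 subr0 unormA unorm0 expr0n /=; case: ger0P => //; lra.
pose w := t^-1 *: (k * k).
have sw : star w = w by rewrite (ustarZ HU) (ustarM HU) sk.
have w1 : nrm w <= 1.
  by rewrite (unormZ HU) unorm_sa // gtr0_norm ?invr_gt0 // ler_pdivrMl // mulr1.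
have [y [y1 yw sy cy]] := unorm_root w1.
have E : t%:A - k * k = t *: ((1 - y) * (1 - y)).
  rewrite mulrBr mulr1 mulrBl mul1r.
  have -> : 1 - y - (y - y * y) = 1 - w.
    have -> : w = 2 *: y - y * y by rewrite yw addrK.
    by rewrite scaler_nat mulr2n !opprB -!addrA; congr (_ + _);
      rewrite addrCA -opprD.
  by rewrite scalerBr scalerA divff ?scale1r // gt_eqF.
pose s := Num.sqrt t; have ss : s * s = t by rewrite -expr2 sqr_sqrtr // ltW.
have sy1 : star (1 - y) = 1 - y by rewrite ustarB ustar1 sy.
have : nrm (s *: (1 - y)) ^+ 2 <= `|t|.
  apply: (@unorm_pyth _ k).
  - by rewrite (ustarZ HU) sy1.
  - by [].
  - apply: commr_sym; rewrite /GRing.comm -scalerAr -scalerAl; congr (_ *: _).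
    apply: commrB; first exact: commr1.
    apply: cy; rewrite /GRing.comm -scalerAr -scalerAl; congr (_ *: _).
    by rewrite mulrA.
  - by rewrite -scalerAl -scalerAr scalerA ss -E subrK.
rewrite E (unormZ HU s) (unormZ HU t) unorm_sa // exprMn real_normK ?num_real //.
by rewrite (expr2 s) ss gtr0_norm.
Qed.

Lemma npos_sq k : star k = k -> npos (k * k).
Proof.
move=> sk; split; first by rewrite (ustarM HU) sk.
by exists (nrm k ^+ 2); apply: npos_sq_norm.
Qed.

Lemma npos_norm h t : npos h -> nrm h <= t -> nrm (t%:A - h) <= t.
Proof.
move=> /npos_sqrt [k [sk _ <- _]]; rewrite unorm_sa //; exact: npos_sq_norm.
Qed.

Lemma nposD x y : npos x -> npos y -> npos (x + y).
Proof.
move=> [sx [t xt]] [sy [t' yt]]; split; first by rewrite (ustarD HU) sx sy.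
exists (t + t'); rewrite scalerDl opprD addrACA.
by apply: le_trans (unormD HU _ _) _; apply: lerD.
Qed.

Lemma nposZ t x : 0 <= t -> npos x -> npos (t *: x).
Proof.
move=> t0 [sx [s xs]]; split; first by rewrite (ustarZ HU) sx.
by exists (t * s); rewrite -scalerA -scalerBr (unormZ HU) ger0_norm // ler_wpM2l.
Qed.

Lemma npos_sub_norm h t : star h = h -> nrm h <= t -> npos (t%:A - h).
Proof.
move=> sh ht; split; first by rewrite ustarB ustarA sh.
by exists t; rewrite opprB addrC subrK.
Qed.

Lemma npos_le_norm h t : npos h -> npos (t%:A - h) -> nrm h <= `|t|.
Proof.
move=> /npos_sqrt [k [sk _ kk ck]] /npos_sqrt [l [sl _ ll cl]].
rewrite -kk unorm_sa //; apply: (@unorm_pyth _ l) => //; last first.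
  by rewrite kk ll addrC subrK.
apply: cl; rewrite -kk; apply: commrB.
  by rewrite /GRing.comm -scalerAr mulr1 -scalerAl mul1r.
by rewrite /GRing.comm mulrA.
Qed.

(** Both |q| - q and q - p are positive, hence so is |q| - p, and a positive
element below the scalar |q| has norm at most |q|. *)
Lemma npos_mono p q : npos p -> npos (q - p) -> nrm p <= nrm q.
Proof.
move=> p0 qp.
have sq : star q = q.
  by move: qp.1; rewrite ustarB p0.1 => /addIr.
rewrite -(ger0_norm (unorm_ge0 q)); apply: npos_le_norm => //.
have -> : (nrm q)%:A - p = ((nrm q)%:A - q) + (q - p) by rewrite addrA subrK.
by apply: nposD => //; apply: npos_sub_norm.
Qed.

(** This is twice the sum of the squares of the real and imaginary parts of [y]. *)
Lemma npos_anticomm y : npos (y * star y + star y * y).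
Proof.
pose S := y * y + star y * star y; pose D := y * star y + star y * y.
have E1 : (y + star y) * (y + star y) = S + D.
  by rewrite mulrDr !mulrDl [y * star y + _]addrC addrACA [star y * y + _]addrC.
have E2 : ii * (y - star y) * (ii * (y - star y)) = D - S.
  rewrite mulrA (iiC HU (ii * _)) mulrA (ii2 HU) mulN1r mulNr.
  rewrite mulrBr !mulrBl !opprB /D /S opprD.
  by rewrite addrACA [- (star y * star y) + _]addrC.
have -> : y * star y + star y * y = 2^-1 *:
   ((y + star y) * (y + star y) + (ii * (y - star y)) * (ii * (y - star y))).
  by rewrite E1 E2 [S + D]addrC addrACA subrr addr0 half_double.
apply: nposZ; first lra.
apply: nposD; apply: npos_sq; first by rewrite (ustarD HU) (ustarK HU) addrC.
by rewrite (ustarM HU) ustarB (ustarK HU) (star_ii HU) mulrN (iiC HU) -mulrN opprB.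
Qed.

(** The spectra of y^* y and y y^* agree up to 0, so y^* y <= 0 should force y = 0.
Here is a proof without spectra.  The element q = y y^* equals
(y y^* + y^* y) + p^2 and is therefore positive, of norm M = |p|^2, whence
|M - q| <= M and |y^* (M - q) y| <= M^2.  But y^* (M - q) y = - (M p^2 + p^4), and
since p^2 has norm M, the norm of M p^2 + p^4 should be 2 M^2; completing the
square turns this into a contradiction unless M = 0. *)
Lemma no_negative_square y p : star p = p -> star y * y = - (p * p) -> p = 0.
Proof.
move=> sp yp; pose q := y * star y; pose M := nrm p ^+ 2.
have M0 : 0 <= M by rewrite exprn_ge0 // unorm_ge0.
have q0 : npos q.
  have -> : q = y * star y + star y * y + p * p by rewrite yp addrNK.
  by apply: nposD; [exact: npos_anticomm | exact: npos_sq].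
have yM : nrm y ^+ 2 = M by rewrite -(unorm_star HU) yp unormN unorm_sa.
have qM : nrm (M%:A - q) <= M.
  apply: npos_norm => //.
  by rewrite /q -{1}(ustarK HU y) (unorm_star HU) unorm_adj yM.
pose P := p * p.
have sP : star P = P by rewrite (ustarM HU) sp.
have E : star y * (M%:A - q) * y = - (M *: P + P * P).
  have yqy : star y * q * y = P * P.
    by rewrite /q [star y * (y * _)]mulrA -mulrA yp mulrNN.
  by rewrite mulrBr mulrBl yqy -scalerAr mulr1 -scalerAl yp opprD scalerN.
have N1 : nrm (M *: P + P * P) <= M ^+ 2.
  rewrite -unormN -E; apply: le_trans (unormM HU _ _) _.
  have := unormM HU (star y) (M%:A - q); rewrite unorm_adj.
  have := unorm_ge0 y; have := unorm_ge0 (M%:A - q).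
  by move: qM yM M0; move: (nrm (_ - q)) (nrm (_ * _)) (nrm y) => *; nra.
(* g^2 = P^2 + M P + M^2 / 4 has norm at most 5 M^2 / 4, while |g| = |P| + M / 2. *)
pose g := P + (M / 2)%:A.
have sg : star g = g by rewrite (ustarD HU) sP ustarA.
have ng : npos g.
  apply: nposD; first exact: npos_sq.
  rewrite -[1 : U]mulr1; apply: nposZ; first lra.
  by apply: npos_sq; rewrite ustar1.
have gg : nrm g ^+ 2 <= M ^+ 2 + M ^+ 2 / 4.
  rewrite -unorm_sa //.
  have -> : g * g = M *: P + P * P + (M ^+ 2 / 4)%:A.
    have -> : M ^+ 2 / 4 = M / 2 * (M / 2) by field.
    have -> : M *: P = (M / 2) *: P + (M / 2) *: P.
      by rewrite -scalerDl; congr (_ *: _); field.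
    rewrite /g; move: (M / 2) => c.
    rewrite mulrDr !mulrDl -!scalerAr -!scalerAl !mulr1 !mul1r scalerA.
    by rewrite addrA -(addrA (P * P)) [P * P + _]addrC.
  apply: le_trans (unormD HU _ _) _; rewrite unormA ger0_norm; last by nra.
  by rewrite lerD2r.
have PG : nrm P <= `|nrm g - M / 2|.
  apply: npos_le_norm; first exact: npos_sq.
  have -> : (nrm g - M / 2)%:A - P = (nrm g)%:A - g.
    by rewrite scalerBl opprD addrA addrAC.
  exact: npos_sub_norm.
have PM : nrm P = M by rewrite unorm_sa.
have M00 : M = 0.
  move: PG gg; rewrite PM; have := unorm_ge0 g; move: (nrm g) => G G0.
  by case: ger0P => *; nra.
by apply: (unorm_eq0 HU); apply/eqP; rewrite -sqrf_eq0 -/M M00.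
Qed.

(** The theorem of Fukamiya and Kaplansky.  Let h = c^* c, r = |h| and g = r - h,
which is twice the negative part of h.  Then h g = - r g, and y = c g sqrt(r)
satisfies y^* y = - (r g)^2.  So r g = 0, hence g^2 = 0 and h = |h|. *)
Theorem npos_star c : npos (star c * c).
Proof.
pose h := star c * c.
have sh : star h = h by rewrite (ustarM HU) (ustarK HU).
(* [r] is |h| and [m] is its square root. *)
have [r [sr nr rr cr]] := npos_sqrt (npos_sq sh).
have [m [sm _ mm cm]] := npos_sqrt nr.
have hr : h * r = r * h by apply: cr; rewrite /GRing.comm mulrA.
have hm : h * m = m * h by apply: cm.
have rm : r * m = m * r by exact: cm.
pose g := r - h.
have sg : star g = g by rewrite ustarB sr sh.
have rg : r * g = g * r by rewrite mulrBr mulrBl hr.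
have gm : g * m = m * g by rewrite mulrBr mulrBl hm rm.
have hg : h * g = - (r * g) by rewrite !mulrBr opprB rr hr.
have gg : g * g = r * g + r * g by rewrite {1}/g mulrBl hg opprK.
have y2 : star (c * g * m) * (c * g * m) = - ((r * g) * (r * g)).
  rewrite !(ustarM HU) sm sg -!mulrA [star c * _]mulrA -/h.
  rewrite [h * _]mulrA hg mulNr !mulrN; congr (- _).
  rewrite -mulrA gm [r * (m * g)]mulrA rm -[m * r * g]mulrA.
  rewrite [g * (m * _)]mulrA gm !mulrA mm -!mulrA.
  by rewrite [g * (r * g)]mulrA -rg mulrA.
have rg0 : r * g = 0.
  apply: (no_negative_square _ y2); by rewrite (ustarM HU) sr sg rg.
have g0 : g = 0 by apply: sa_sq_eq0; rewrite ?gg ?rg0 ?addr0.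
by move: nr; rewrite -[r](subrK h) -/g g0 add0r.
Qed.

Lemma npos_closed h :
  (forall e, 0 < e -> exists2 x, npos x & nrm (x - h) <= e) -> npos h.
Proof.
move=> hh; split.
  apply/eqP; rewrite -subr_eq0; apply/eqP/unorm_le0 => e e0.
  have [|x [sx _] xh] := hh (e / 2); first lra.
  rewrite -(subrK x (star h)) -addrA.
  apply: le_trans (unormD HU _ _) _.
  rewrite -{1}sx -ustarB unorm_adj unormC; lra.
exists (nrm h + 1); apply/ler_addgt0Pl => e e0.
have [|x nx xh] := hh (Num.min e 1); first by rewrite lt_min e0 ltr01.
move: xh; rewrite le_min => /andP[xe x1].
have x1' : nrm x <= nrm h + 1.
  by rewrite -(subrK h x); apply: le_trans (unormD HU _ _) _; lra.
have := npos_norm nx x1'.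
have -> : (nrm h + 1)%:A - h = (x - h) + ((nrm h + 1)%:A - x).
  by rewrite [RHS]addrC addrA subrK.
by have := unormD HU (x - h) ((nrm h + 1)%:A - x); lra.
Qed.

End UnitalCStar.

(** * Norms with values in the real field, and the unitization *)

Section RealNorm.
Context {R : realType}.

(** Norms over [R[i]] are complex numbers; [rnorm] is the same norm with values
in the ordered field [R], and [cmod] the modulus. *)
Definition rnorm (V : normedModType R[i]) (x : V) : R := complex.Re `|x|.

Definition cmod (z : R[i]) : R := complex.Re `|z|.

Lemma cmodE (z : R[i]) : `|z| = (cmod z)%:C.
Proof. by rewrite /cmod normc_def. Qed.

Lemma cmod_ge0 (z : R[i]) : 0 <= cmod z.
Proof. by have := normr_ge0 z; rewrite cmodE ler0c. Qed.

Lemma cmodD (z w : R[i]) : cmod (z + w) <= cmod z + cmod w.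
Proof. by have := ler_normD z w; rewrite !cmodE -rmorphD lecR. Qed.

Lemma cmod0 : cmod 0 = 0.
Proof. by rewrite /cmod normr0. Qed.

Lemma cmod_eq0 (z : R[i]) : cmod z = 0 -> z = 0.
Proof. by move=> z0; apply/eqP; rewrite -normr_eq0 cmodE z0. Qed.

Context {V : normedModType R[i]}.
Implicit Types (x y : V).

Lemma rnormE x : `|x| = (rnorm x)%:C.
Proof.
have := normr_ge0 x; rewrite lecE /= => /andP[/eqP im _].
by rewrite [LHS]complexE im /rnorm mulr0 addr0.
Qed.

Lemma rnorm_ge0 x : 0 <= rnorm x.
Proof. by have := normr_ge0 x; rewrite rnormE ler0c. Qed.

Lemma rnormD x y : rnorm (x + y) <= rnorm x + rnorm y.
Proof. by have := ler_normD x y; rewrite !rnormE -rmorphD lecR. Qed.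

Lemma rnorm0 : rnorm (0 : V) = 0.
Proof. by rewrite /rnorm normr0. Qed.

Lemma rnormN x : rnorm (- x) = rnorm x.
Proof. by rewrite /rnorm normrN. Qed.

Lemma rnormB x y : rnorm (x - y) <= rnorm x + rnorm y.
Proof. by rewrite -(rnormN y) rnormD. Qed.

Lemma rnormC x y : rnorm (x - y) = rnorm (y - x).
Proof. by rewrite -rnormN opprB. Qed.

Lemma rnorm_eq0 x : rnorm x = 0 -> x = 0.
Proof. by move=> x0; apply/eqP; rewrite -normr_eq0 rnormE x0. Qed.

Lemma rnormZ (z : R[i]) x : rnorm (z *: x) = cmod (z) * rnorm x.
Proof.
by apply: complexI; rewrite rmorphM /= -!rnormE normrZ -cmodE.
Qed.

Lemma cmod_real (t : R) : cmod (t%:C) = `|t|.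
Proof. by rewrite /cmod normc_def /= expr0n addr0 sqrtr_sqr. Qed.

Lemma cmodM (z w : R[i]) : cmod (z * w) = cmod (z) * cmod (w).
Proof. by apply: complexI; rewrite rmorphM /= -!cmodE normrM. Qed.

Lemma rnormZr (t : R) x : rnorm (t%:C *: x) = `|t| * rnorm x.
Proof. by rewrite rnormZ cmod_real. Qed.

End RealNorm.

Section CStarNorm.
Context {R : realType} {A : cstarAlgType R}.
Implicit Types (a b : A).

Lemma rnormM a b : rnorm (cmul a b) <= rnorm a * rnorm b.
Proof. by have := normcM_le a b; rewrite !rnormE -rmorphM lecR. Qed.

Lemma rnorm_cstar a : rnorm (cmul (adj a) a) = rnorm a ^+ 2.
Proof. by apply: complexI; rewrite -rnormE cstar_norm rnormE rmorphXn. Qed.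

Lemma cmul0r a : cmul 0 a = 0.
Proof. by rewrite -(scale0r (0 : A)) cmulZl !scale0r. Qed.

Lemma cmulr0 a : cmul a 0 = 0.
Proof. by rewrite -(scale0r (0 : A)) cmulZr !scale0r. Qed.

Lemma adj0 : adj (0 : A) = 0.
Proof. by rewrite -(scale0r (0 : A)) adjZ rmorph0 !scale0r. Qed.

Lemma adjN a : adj (- a) = - adj a.
Proof. by rewrite -scaleN1r adjZ rmorphN1 scaleN1r. Qed.

Lemma adjB a b : adj (a - b) = adj a - adj b.
Proof. by rewrite adjD adjN. Qed.

Lemma cmulNr a b : cmul (- a) b = - cmul a b.
Proof. by rewrite -scaleN1r cmulZl scaleN1r. Qed.

Lemma cmulrN a b : cmul a (- b) = - cmul a b.
Proof. by rewrite -scaleN1r cmulZr scaleN1r. Qed.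

Lemma rnorm_adj a : rnorm (adj a) = rnorm a.
Proof.
have le_adj b : rnorm b <= rnorm (adj b).
  have [/eqP y0|y0] := boolP (rnorm b == 0); first by rewrite y0 rnorm_ge0.
  have y1 : 0 < rnorm b by rewrite lt_neqAle eq_sym y0 rnorm_ge0.
  by rewrite -(ler_pM2r y1) -expr2 -rnorm_cstar rnormM.
by apply/le_anti; rewrite le_adj -{2}(adjK a) le_adj.
Qed.

Lemma cstar_eq0 a : cmul (adj a) a = 0 -> a = 0.
Proof.
move=> a0; apply: rnorm_eq0; apply/eqP.
by rewrite -sqrf_eq0 -rnorm_cstar a0 rnorm0.
Qed.

End CStarNorm.

(** The unitization A + C 1.  As the algebra [A] may itself have a unit, the
operator norm alone need not separate points of [A * R[i]]; see [unrm]. *)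
Definition unitization (R : realType) (A : cstarAlgType R) : Type := (A * R[i])%type.

Section Unitization.
Context {R : realType} {A : cstarAlgType R}.
Implicit Types (u v : unitization A) (t : R).

HB.instance Definition _ := GRing.Zmodule.copy (unitization A) (A * R[i])%type.

Let U1 : unitization A := (0, 1).
Definition umul u v : unitization A :=
  (cmul u.1 v.1 + v.2 *: u.1 + u.2 *: v.1, u.2 * v.2).

Fact umulA : associative umul.
Proof.
move=> [a z] [b w] [c y]; congr (_, _) => /=; last by rewrite mulrA.
rewrite !cmulDr !cmulDl !cmulZl !cmulZr !scalerDr !scalerA cmulA.
rewrite !addrA [RHS](ACl (1*4*2*5*3*6*7)) /=.
by rewrite [y * z]mulrC [y * w]mulrC.
Qed.

Fact umul1r : left_id U1 umul.
Proof.
by move=> [a z]; congr (_, _) => /=; rewrite ?mul1r // cmul0r scaler0 scale1r !add0r.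
Qed.

Fact umulr1 : right_id U1 umul.
Proof.
by move=> [a z]; congr (_, _) => /=; rewrite ?mulr1 // cmulr0 scaler0 scale1r add0r addr0.
Qed.

Fact umulDl : left_distributive umul +%R.
Proof.
move=> [a z] [b w] [c y]; congr (_, _) => /=; last by rewrite mulrDl.
by rewrite cmulDl scalerDr scalerDl !addrA [RHS](ACl (1*4*2*5*3*6)).
Qed.

Fact umulDr : right_distributive umul +%R.
Proof.
move=> [a z] [b w] [c y]; congr (_, _) => /=; last by rewrite mulrDr.
by rewrite cmulDr scalerDr scalerDl !addrA [RHS](ACl (1*4*2*5*3*6)).
Qed.

Fact u1_neq0 : U1 != 0.
Proof. by apply/eqP => -[/eqP]; rewrite oner_eq0. Qed.

HB.instance Definition _ := GRing.Zmodule_isNzRing.Build (unitization A)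
  umulA umul1r umulr1 umulDl umulDr u1_neq0.

Definition uscale t u : unitization A := (t%:C *: u.1, t%:C * u.2).

Fact uscaleA s t u : uscale s (uscale t u) = uscale (s * t) u.
Proof. by congr (_, _); rewrite /= ?scalerA ?mulrA rmorphM. Qed.

Fact uscale1 : left_id 1 uscale.
Proof. by move=> [a z]; congr (_, _); rewrite /= ?scale1r ?mul1r. Qed.

Fact uscaleDr : right_distributive uscale +%R.
Proof. by move=> t u v; congr (_, _); rewrite /= ?scalerDr ?mulrDr. Qed.

Fact uscaleDl u : {morph uscale^~ u : s t / s + t}.
Proof. by move=> s t; congr (_, _); rewrite /= rmorphD ?scalerDl ?mulrDl. Qed.

HB.instance Definition _ := GRing.Zmodule_isLmodule.Build R (unitization A)
  uscaleA uscale1 uscaleDr uscaleDl.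

Fact uscaleAl t u v : t *: (u * v) = t *: u * v.
Proof.
congr (_, _); rewrite /= ?mulrA //.
by rewrite cmulZl !scalerDr !scalerA [v.2 * _]mulrC.
Qed.

HB.instance Definition _ := GRing.Lmodule_isLalgebra.Build R (unitization A) uscaleAl.

Fact uscaleAr t u v : t *: (u * v) = u * (t *: v).
Proof.
congr (_, _); rewrite /= 1?mulrCA //.
by rewrite cmulZr !scalerDr !scalerA [u.2 * _]mulrC.
Qed.

HB.instance Definition _ := GRing.Lalgebra_isAlgebra.Build R (unitization A) uscaleAr.

Definition ustar u : unitization A := (adj u.1, Num.conj u.2).
Definition uact u (x : A) : A := cmul u.1 x + u.2 *: x.
Definition ubound u t : Prop :=
  cmod (u.2) <= t /\ forall x, rnorm (uact u x) <= t * rnorm x.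
(** The maximum of the modulus of the scalar part and of the norm of the operator
x |-> a x + z x on [A], written as the least common bound.  Including the scalar
part makes this a norm even when [A] is unital: the algebra is then the product
of [A] and the complex numbers. *)
Definition unrm u : R := inf [set t | ubound u t].
Definition uii : unitization A := (0, 'i).

End Unitization.

Section UnitizationNorm.
Context {R : realType} {A : cstarAlgType R}.
Implicit Types (u v : unitization A) (t : R).

Lemma conjc_rc t : Num.conj t%:C = t%:C :> R[i].
Proof. by rewrite conj_Creal // complex_real. Qed.

Lemma conjc_i : Num.conj ('i : R[i]) = - 'i.
Proof. by apply/eqP; rewrite eq_complex /= oppr0 !eqxx. Qed.

Lemma cmod_conj (z : R[i]) : cmod (Num.conj z) = cmod z.
Proof. by rewrite /cmod norm_conjC. Qed.

Lemma uactM u v x : uact (u * v) x = uact u (uact v x).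
Proof.
rewrite /uact /= !cmulDl !cmulDr !cmulZl cmulZr scalerDr !scalerA -cmulA.
by rewrite !addrA.
Qed.

Lemma uactD u v x : uact (u + v) x = uact u x + uact v x.
Proof. by rewrite /uact /= cmulDl scalerDl addrACA. Qed.

Lemma uactZ t u x : uact (t *: u) x = t%:C *: uact u x.
Proof. by rewrite /uact /= cmulZl scalerDr scalerA. Qed.

Lemma uact_adj u x y : cmul (adj (uact u x)) y = cmul (adj x) (uact (ustar u) y).
Proof. by rewrite /uact /= adjD adjM adjZ cmulDl cmulDr cmulZl cmulZr cmulA. Qed.

Lemma ubound_ge0 u t : ubound u t -> 0 <= t.
Proof. by case=> + _; apply: le_trans; apply: cmod_ge0. Qed.

Lemma ubound_unrm u : ubound u (unrm u).
Proof.
have ne : [set t | ubound u t] !=set0.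
  exists (cmod (u.2) + rnorm u.1); split.
    by rewrite lerDl rnorm_ge0.
  move=> x; rewrite /uact addrC mulrDl.
  by apply: le_trans (rnormD _ _) _; rewrite rnormZ lerD2l rnormM.
split; first by apply: lb_le_inf => // t [].
move=> x; have [/eqP x0|x0] := boolP (rnorm x == 0).
  rewrite x0 mulr0 (rnorm_eq0 x0) /uact cmulr0 scaler0 addr0 rnorm0 //.
have x1 : 0 < rnorm x by rewrite lt_neqAle eq_sym x0 rnorm_ge0.
rewrite -ler_pdivrMr //; apply: lb_le_inf => // t [_ ut].
by rewrite ler_pdivrMr.
Qed.

Lemma unrm_le u t : ubound u t -> unrm u <= t.
Proof.
move=> ut; apply: ge_inf => //.
by exists 0 => s; apply: ubound_ge0.
Qed.

Lemma unrm_ge0 u : 0 <= unrm u.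
Proof. exact: ubound_ge0 (ubound_unrm u). Qed.

Definition uinj (a : A) : unitization A := (a, 0).

(** The lower bound comes from applying the operator to a^*. *)
Lemma unrm_inj a : unrm (uinj a) = rnorm a.
Proof.
have Ea x : uact (uinj a) x = cmul a x by rewrite /uact /= scale0r addr0.
apply/le_anti/andP; split.
  apply: unrm_le; split => [|x]; first by rewrite (_ : (uinj a).2 = 0) // cmod0 rnorm_ge0.
  by rewrite Ea rnormM.
have [/eqP y0|y0] := boolP (rnorm a == 0); first by rewrite y0 unrm_ge0.
have y1 : 0 < rnorm a by rewrite lt_neqAle eq_sym y0 rnorm_ge0.
have [_ /(_ (adj a))] := ubound_unrm (uinj a).
rewrite Ea -{1}(adjK a) rnorm_cstar rnorm_adj expr2 ler_pM2r //.
Qed.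

Lemma unrm_le_sum u : unrm u <= rnorm u.1 + cmod (u.2).
Proof.
apply: unrm_le; split; first by rewrite lerDr rnorm_ge0.
move=> x; rewrite /uact mulrDl.
by apply: le_trans (rnormD _ _) _; rewrite rnormZ lerD2r rnormM.
Qed.

Lemma unrmD u v : unrm (u + v) <= unrm u + unrm v.
Proof.
have [u1 u2] := ubound_unrm u; have [v1 v2] := ubound_unrm v.
apply: unrm_le; split => [|x].
  apply: le_trans (lerD u1 v1).
  exact: cmodD.
rewrite uactD mulrDl; apply: le_trans (rnormD _ _) _.
exact: lerD.
Qed.

Lemma unrmM u v : unrm (u * v) <= unrm u * unrm v.
Proof.
have [u1 u2] := ubound_unrm u; have [v1 v2] := ubound_unrm v.
apply: unrm_le; split => [|x].
  by rewrite /= cmodM; apply: ler_pM => //; apply: cmod_ge0.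
rewrite uactM; apply: le_trans (u2 _) _.
by rewrite -mulrA ler_wpM2l // unrm_ge0.
Qed.

Lemma unrmZ_le t u : unrm (t *: u) <= `|t| * unrm u.
Proof.
have [u1 u2] := ubound_unrm u.
apply: unrm_le; split => [|x].
  by rewrite /= cmodM cmod_real ler_wpM2l.
by rewrite uactZ rnormZr -mulrA ler_wpM2l.
Qed.

Lemma unrmZ t u : unrm (t *: u) = `|t| * unrm u.
Proof.
apply/le_anti; rewrite unrmZ_le /=.
have [->|t0] := eqVneq t 0.
  by rewrite normr0 mul0r unrm_ge0.
rewrite -ler_pdivlMl ?normr_gt0 // -normfV -{1}[u](scalerK t0).
exact: unrmZ_le.
Qed.

Lemma unrm_eq0 u : unrm u = 0 -> u = 0.
Proof.
move=> u0; have [u1 u2] := ubound_unrm u; rewrite u0 in u1 u2.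
have u20 : u.2 = 0.
  by apply/cmod_eq0/le_anti; rewrite u1 cmod_ge0.
have : unrm (uinj u.1) = 0 by rewrite -u0; congr unrm; rewrite /uinj -u20; case: (u).
rewrite unrm_inj => /rnorm_eq0 u10.
by rewrite [u]surjective_pairing u10 u20.
Qed.

Lemma ustarMu u v : ustar (u * v) = ustar v * ustar u.
Proof.
congr (_, _); rewrite /= ?rmorphM 1?mulrC //.
by rewrite !adjD adjM !adjZ addrAC.
Qed.

Lemma ustarKu u : ustar (ustar u) = u.
Proof. by rewrite [RHS]surjective_pairing /ustar /= adjK conjCK. Qed.

(** For the operator part, |u x|^2 = |x^* (u^* u x)| by the C*-identity of [A].  This
gives |u|^2 <= |u^* u|, hence |u| = |u^*|, hence the converse. *)
Lemma unrm_star u : unrm (ustar u * u) = unrm u ^+ 2.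
Proof.
have star_le v : unrm v ^+ 2 <= unrm (ustar v * v).
  set s := unrm (ustar v * v); have s0 : 0 <= s by apply: unrm_ge0.
  have [v1 v2] := ubound_unrm (ustar v * v).
  rewrite -[leRHS]sqr_sqrtr // lerXn2r ?nnegrE ?unrm_ge0 ?sqrtr_ge0 //.
  apply: unrm_le; split => [|x].
    rewrite -[leLHS]ger0_norm; last exact: cmod_ge0.
    rewrite -sqrtr_sqr ler_sqrt //; apply: le_trans v1.
    by rewrite expr2 -{1}(cmod_conj v.2) -cmodM.
  rewrite -[leLHS]ger0_norm ?rnorm_ge0 // -[X in _ * X]ger0_norm ?rnorm_ge0 //.
  rewrite -!sqrtr_sqr -sqrtrM // ler_sqrt ?mulr_ge0 ?rnorm_ge0 //.
  rewrite -rnorm_cstar uact_adj -uactM.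
  apply: le_trans (rnormM _ _) _; rewrite rnorm_adj expr2 mulrCA.
  by rewrite ler_wpM2l ?rnorm_ge0.
have star_norm v : unrm v <= unrm (ustar v).
  have [/eqP y0|y0] := boolP (unrm v == 0); first by rewrite y0 unrm_ge0.
  have y1 : 0 < unrm v by rewrite lt_neqAle eq_sym y0 unrm_ge0.
  rewrite -(ler_pM2r y1) -expr2; apply: le_trans (star_le v) _.
  exact: unrmM.
apply/le_anti; rewrite star_le andbT; apply: le_trans (unrmM _ _) _.
by rewrite expr2 ler_wpM2r ?unrm_ge0 // -{2}(ustarKu u).
Qed.

End UnitizationNorm.

(** * Completeness of the unitization, and the positive cone *)

Section RealConvergence.
Context {R : realType}.

Lemma posC_real (e : R[i]) : 0 < e -> e = (complex.Re e)%:C /\ 0 < complex.Re e.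
Proof.
rewrite ltcE /= => /andP[/eqP im re]; split => //.
by rewrite [LHS]complexE im mulr0 addr0.
Qed.

Lemma rcvgP (V : normedModType R[i]) (u : nat -> V) (l : V) :
  u @ \oo --> l <-> forall eps : R, 0 < eps -> exists N, forall p, (N <= p)%N ->
    rnorm (u p - l) < eps.
Proof.
split.
  move=> /cvgrPdist_lt ul eps e0.
  have [|N _ hN] := ul eps%:C; first by rewrite ltcR.
  by exists N => p /hN /=; rewrite rnormE ltcR rnormC.
move=> ul; apply/cvgrPdist_lt => eps /posC_real [-> e0].
have [N hN] := ul _ e0; exists N => // p /hN.
by rewrite /= rnormE ltcR rnormC.
Qed.

Lemma rcauchy_cvg (V : completeNormedModType R[i]) (u : nat -> V) :
  (forall eps : R, 0 < eps -> exists N, forall p q, (N <= p)%N -> (N <= q)%N ->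
     rnorm (u p - u q) < eps) -> cvgn u.
Proof.
move=> uC; apply/cauchy_cvgP/cauchy_exP => eps /posC_real [-> e0].
have [N hN] := uC _ e0; exists (u N); exists N => // p /= Np.
by rewrite -ball_normE /= rnormE ltcR hN.
Qed.

Lemma rcvg_cauchy (V : normedModType R[i]) (u : nat -> V) : cvgn u ->
  forall eps : R, 0 < eps -> exists N, forall p q, (N <= p)%N -> (N <= q)%N ->
     rnorm (u p - u q) < eps.
Proof.
move=> /cvg_ex[l /rcvgP ul] eps e0.
have [|N hN] := ul (eps / 2); first lra.
exists N => p q /hN h1 /hN h2; rewrite -(subrK l (u p)) -addrA.
by apply: le_lt_trans (rnormD _ _) _; rewrite (rnormC l); lra.
Qed.

End RealConvergence.

Section UnitizationCStar.
Context {R : realType} {A : cstarAlgType R}.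
Implicit Types (u v : unitization A) (t : R).

Lemma real_cauchy (w : nat -> R) :
  (forall eps, 0 < eps -> exists N, forall p q, (N <= p)%N -> (N <= q)%N ->
       `|w p - w q| < eps) ->
    exists l, forall eps, 0 < eps -> exists N, forall p, (N <= p)%N ->
       `|w p - l| < eps.
Proof.
move=> wC; have /cvg_ex[l wl] : cvgn w.
  apply/cauchy_cvgP/cauchy_exP => eps e0.
  have [N hN] := wC _ e0; exists (w N); exists N => // p /= Np.
  by rewrite -ball_normE /= hN.
exists l => eps e0; move/cvgrPdist_lt: wl => /(_ _ e0) [N _ hN].
by exists N => p /hN; rewrite /= distrC.
Qed.

Lemma cmod_ReIm (z : R[i]) : [/\ `|complex.Re z| <= cmod z, `|complex.Im z| <= cmod z
  & cmod z <= `|complex.Re z| + `|complex.Im z|].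
Proof.
have E : cmod z = Num.sqrt (complex.Re z ^+ 2 + complex.Im z ^+ 2).
  by rewrite /cmod normc_def.
split; rewrite E.
- by rewrite -sqrtr_sqr ler_sqrt ?addr_ge0 ?sqr_ge0 // lerDl sqr_ge0.
- by rewrite -sqrtr_sqr ler_sqrt ?addr_ge0 ?sqr_ge0 // lerDr sqr_ge0.
- rewrite -[leRHS]ger0_norm ?addr_ge0 // -sqrtr_sqr ler_sqrt ?sqr_ge0 //.
  by rewrite sqrrD !real_normK ?num_real // addrAC lerDl mulrn_wge0 ?mulr_ge0.
Qed.

(** A Cauchy sequence converges in each component: the norm dominates the scalar
part by definition, and then the part in [A] by the triangle inequality. *)
Lemma unitization_complete (u : nat -> unitization A) :
  (forall eps, 0 < eps -> exists N, forall p q, (N <= p)%N -> (N <= q)%N ->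
     unrm (u p - u q) < eps) ->
  exists l, forall eps, 0 < eps -> exists N, forall p, (N <= p)%N ->
     unrm (u p - l) < eps.
Proof.
move=> uC.
have c2 p q : cmod ((u p).2 - (u q).2) <= unrm (u p - u q).
  by have [] := ubound_unrm (u p - u q).
have [re|lr hr] := @real_cauchy (fun p => complex.Re (u p).2).
  move=> /uC[N hN]; exists N => p q Np Nq; apply: le_lt_trans (hN _ _ Np Nq).
  by apply: le_trans (c2 p q); have [+ _ _] := cmod_ReIm ((u p).2 - (u q).2);
    rewrite raddfB.
have [im|li hi] := @real_cauchy (fun p => complex.Im (u p).2).
  move=> /uC[N hN]; exists N => p q Np Nq; apply: le_lt_trans (hN _ _ Np Nq).
  by apply: le_trans (c2 p q); have [_ + _] := cmod_ReIm ((u p).2 - (u q).2);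
    rewrite raddfB.
have : cvgn (fun p => (u p).1 : A).
  apply: rcauchy_cvg => eps e0; have [|N hN] := uC (eps / 2); first lra.
  exists N => p q Np Nq; rewrite -unrm_inj.
  have -> : uinj ((u p).1 - (u q).1) = (u p - u q) + (0, - ((u p).2 - (u q).2)).
    by congr (_, _); rewrite /= ?addr0 // subrr.
  apply: le_lt_trans (unrmD _ _) _.
  have := hN _ _ Np Nq; have := c2 p q.
  have := unrm_le_sum ((0, - ((u p).2 - (u q).2)) : unitization A).
  by rewrite /= rnorm0 add0r /cmod normrN; lra.
move=> /cvg_ex[a /rcvgP ha].
exists (a, lr +i* li) => eps e0.
have [|N1 h1] := ha (eps / 3); first lra.
have [|N2 h2] := hr (eps / 3); first lra.
have [|N3 h3] := hi (eps / 3); first lra.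
exists (N1 + N2 + N3)%N => p Np.
apply: le_lt_trans (unrm_le_sum _) _.
have [_ _] := cmod_ReIm ((u p).2 - (lr +i* li)).
rewrite raddfB (raddfB (@complex.Im R)) /=.
have k1 := h1 p (leq_trans (leq_trans (leq_addr _ _) (leq_addr _ _)) Np).
have k2 := h2 p (leq_trans (leq_trans (leq_addl _ _) (leq_addr _ _)) Np).
have k3 := h3 p (leq_trans (leq_addl _ _) Np).
by move: k1 k2 k3 => /=; lra.
Qed.

Lemma unitization_cstar : unital_cstar ustar (@unrm R A) uii.
Proof.
split.
- by move=> u v; congr (_, _); [exact: adjD | exact: rmorphD].
- move=> t u; rewrite -[RHS]/(_, _) /ustar; congr (_, _).
    by rewrite adjZ conjc_rc.
  by rewrite (_ : (t *: u).2 = t%:C * u.2) // rmorphM; congr (_ * _); exact: conjc_rc.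
- exact: ustarMu.
- exact: ustarKu.
- exact: unrmD.
- exact: unrmZ.
- exact: unrm_eq0.
- exact: unrmM.
- exact: unrm_star.
- move=> u; congr (_, _); rewrite /= 1?mulrC //.
  by rewrite cmulr0 cmul0r scaler0 !add0r addr0.
- congr (_, _); rewrite /= ?cmul0r ?scaler0 ?oppr0 ?addr0 //.
  by rewrite -expr2 sqr_i.
- congr (_, _); rewrite /= ?adj0 ?oppr0 //; exact: conjc_i.
- exact: unitization_complete.
Qed.

End UnitizationCStar.

Section Positivity.
Context {R : realType} {A : cstarAlgType R}.
Implicit Types (a b c : A).
Let HU := @unitization_cstar R A.
Let upos : unitization A -> Prop := @npos R (unitization A) ustar (@unrm R A).

Lemma uinjM a b : uinj (cmul a b) = uinj a * uinj b.
Proof. by congr (_, _); rewrite /= ?mulr0 // !scale0r !addr0. Qed.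

Lemma uinjB a b : uinj (a - b) = uinj a - uinj b.
Proof. by congr (_, _); rewrite /= subr0. Qed.

Lemma uinj_adj a : uinj (adj a) = ustar (uinj a).
Proof. by congr (_, _); rewrite /= rmorph0. Qed.

(** Left to right is the theorem that c^* c is positive.  Conversely the positive
square root in the unitization has scalar part 0, as the square of this scalar
is the scalar part of an element of [A]. *)
Lemma cposE a : cpos a <-> upos (uinj a).
Proof.
split=> [[c ->]|/(npos_sqrt HU) [k [sk _ kk _]]].
  by rewrite uinjM uinj_adj; apply: npos_star HU _.
have k2 : k.2 = 0.
  have : k.2 * k.2 = 0 by have := congr1 snd kk.
  by move/eqP; rewrite mulf_eq0 orbb => /eqP.
have Ek : k = uinj k.1 by rewrite [LHS]surjective_pairing k2.
exists k.1; have := congr1 fst kk; rewrite -{1}sk {1 2}Ek -uinj_adj -uinjM /= => <- //.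
Qed.

Lemma cpos_sa a : cpos a -> adj a = a.
Proof. by move=> [c ->]; rewrite adjM adjK. Qed.

(** Proved in the unitization, where the scalar |b| is available as an upper
bound. *)
Lemma cle_rnorm a b : cpos a -> cle a b -> rnorm a <= rnorm b.
Proof.
rewrite /cle !cposE uinjB => a0 ab; rewrite -!unrm_inj.
exact: npos_mono HU _ _ a0 ab.
Qed.

(** The limit of elements c_i^* c_i need not visibly come from a limit of the c_i;
the norm description of positivity is what passes to the limit. *)
Lemma cpos_closed (u : nat -> A) a : (forall i, cpos (u i)) -> u @ \oo --> a -> cpos a.
Proof.
move=> u0 /rcvgP ua; apply/cposE/(npos_closed HU) => e /ua [N hN].
exists (uinj (u N)); first exact/cposE.
by rewrite -uinjB unrm_inj ltW // hN.
Qed.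

End Positivity.

(** * Extension by continuity *)

Lemma dense_setT (R : realType) (V : normedModType R[i]) : dense (@setT V).
Proof. by move=> O [x Ox] _; exists x. Qed.

Lemma dense_mono (T : topologicalType) (S S' : set T) : S `<=` S' -> dense S -> dense S'.
Proof.
by move=> SS' dS O O0 Oo; have [x [Ox Sx]] := dS O O0 Oo; exists x; split=> //; exact: SS'.
Qed.

Lemma lspan_mono (K : numFieldType) (V : lmodType K) (S S' : set V) :
  S `<=` S' -> lspan S `<=` lspan S'.
Proof.
by move=> SS' _ [m [c [s [Ss ->]]]]; exists m, c, s; split=> // i; exact: SS'.
Qed.

Section Extension.
Context {R : realType}.

Lemma cvgn_unique (V : normedModType R[i]) (u : nat -> V) (a b : V) :
  u @ \oo --> a -> u @ \oo --> b -> a = b.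
Proof. by move=> ua ub; apply: cvg_unique ua ub. Qed.

Lemma dense_seq (V : normedModType R[i]) (S : set V) (a : V) : dense S ->
  exists2 u : nat -> V, (forall i, S (u i)) & u @ \oo --> a.
Proof.
move=> dS.
have /choice[u hu] i : exists x, S x /\ rnorm (x - a) < i.+1%:R^-1.
  have e0 : 0 < (i.+1%:R^-1 : R) by rewrite invr_gt0 ltr0n.
  have [] := dS (ball a (i.+1%:R^-1 : R)%:C).
  - by exists a; apply: ballxx; rewrite ltcR.
  - by apply: ball_open; rewrite ltcR.
  move=> x [bx Sx]; exists x; split=> //.
  by move: bx; rewrite -ball_normE /= rnormE ltcR rnormC.
exists u => [i|]; first by have [] := hu i.
apply/rcvgP => eps e0.
have [N _ hN] := near_infty_natSinv_lt (PosNum e0).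
exists N => p Np; have [_] := hu p; move=> h; apply: lt_trans h _.
exact: hN.
Qed.


Context {V1 V2 : normedModType R[i]} {V3 : completeNormedModType R[i]}.

(** [g] is the continuous extension of [f], expressed by sequences: this is the form
in which the completed operations are used.  No linearity is included, so
the notion covers the sesquilinear inner products as well. *)
Definition extends_by_limits (S1 : set V1) (S2 : set V2) (f g : V1 -> V2 -> V3) :=
  forall a b u v, (forall i, S1 (u i)) -> (forall i, S2 (v i)) ->
    u @ \oo --> a -> v @ \oo --> b -> (fun i => f (u i) (v i)) @ \oo --> g a b.

(** Additivity is only asked for differences, the one form that the uniform
continuity estimate uses. *)
Record bounded_biadditive (S1 : set V1) (S2 : set V2) (f : V1 -> V2 -> V3)
    (C : R) : Prop := {
  bbBl : forall x x' y, S1 x -> S1 x' -> S2 y -> f (x - x') y = f x y - f x' y;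
  bbBr : forall x y y', S1 x -> S2 y -> S2 y' -> f x (y - y') = f x y - f x y';
  bb_le : forall x y, S1 x -> S2 y -> rnorm (f x y) <= C * (rnorm x * rnorm y)
}.

(** Uniform continuity near (a, b), from
f x y - f x' y' = f (x - x') y + f x' (y - y'). *)
Lemma bounded_biadditive_dist (S1 : set V1) (S2 : set V2) f C a b (eps : R) :
  (forall x y, S1 x -> S1 y -> S1 (x - y)) ->
  (forall x y, S2 x -> S2 y -> S2 (x - y)) ->
  bounded_biadditive S1 S2 f C -> 0 < eps ->
  exists2 delta, 0 < delta & forall x x' y y', S1 x -> S1 x' -> S2 y -> S2 y' ->
    rnorm (x - a) < delta -> rnorm (x' - a) < delta ->
    rnorm (y - b) < delta -> rnorm (y' - b) < delta ->
    rnorm (f x y - f x' y') < eps.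
Proof.
move=> S1B S2B fC e0.
pose K := 2 * (`|C| + 1) * (rnorm a + rnorm b + 2).
have a0 := rnorm_ge0 a; have b0 := rnorm_ge0 b; have C0 : 0 <= `|C| by [].
have K0 : 0 < K by rewrite /K; nra.
have d0 : 0 < Num.min 1 (eps / K) by rewrite lt_min ltr01 divr_gt0.
exists (Num.min 1 (eps / K)) => // x x' y y' Sx Sx' Sy Sy'.
have : Num.min 1 (eps / K) <= 1 by rewrite ge_min lexx.
have : Num.min 1 (eps / K) <= eps / K by rewrite ge_min lexx orbT.
rewrite ler_pdivlMr //; move: (Num.min _ _) d0 => d d0 dK d1 xa xa' yb yb'.
have -> : f x y - f x' y' = f (x - x') y + f x' (y - y').
  by rewrite (bbBl fC) // (bbBr fC) // addrA subrK.
apply: le_lt_trans (rnormD _ _) _.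
have h1 := bb_le fC (S1B _ _ Sx Sx') Sy; have h2 := bb_le fC Sx' (S2B _ _ Sy Sy').
have xx : rnorm (x - x') <= 2 * d.
  rewrite -(subrK a x) -addrA; apply: le_trans (rnormD _ _) _.
  by rewrite (rnormC a); lra.
have yy : rnorm (y - y') <= 2 * d.
  rewrite -(subrK b y) -addrA; apply: le_trans (rnormD _ _) _.
  by rewrite (rnormC b); lra.
have ny : rnorm y <= rnorm b + 1.
  by rewrite -(subrK b y); apply: le_trans (rnormD _ _) _; lra.
have nx' : rnorm x' <= rnorm a + 1.
  by rewrite -(subrK a x'); apply: le_trans (rnormD _ _) _; lra.
have CC : C <= `|C| by exact: ler_norm.
have p1 : rnorm (x - x') * rnorm y <= 2 * d * (rnorm b + 1).
  by apply: ler_pM => //; exact: rnorm_ge0.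
have p2 : rnorm x' * rnorm (y - y') <= (rnorm a + 1) * (2 * d).
  by apply: ler_pM => //; exact: rnorm_ge0.
have q1 : 0 <= rnorm (x - x') * rnorm y by rewrite mulr_ge0 ?rnorm_ge0.
have q2 : 0 <= rnorm x' * rnorm (y - y') by rewrite mulr_ge0 ?rnorm_ge0.
have r1 : C * (rnorm (x - x') * rnorm y) <= `|C| * (2 * d * (rnorm b + 1)).
  by apply: le_trans (ler_wpM2l C0 p1); rewrite ler_wpM2r.
have r2 : C * (rnorm x' * rnorm (y - y')) <= `|C| * ((rnorm a + 1) * (2 * d)).
  by apply: le_trans (ler_wpM2l C0 p2); rewrite ler_wpM2r.
have : `|C| * (2 * d * (rnorm b + 1)) + `|C| * ((rnorm a + 1) * (2 * d)) < eps.
  apply: lt_le_trans dK; rewrite /K.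
  have : 0 < d * (rnorm a + rnorm b + 2) by nra.
  lra.
lra.
Qed.

(** One sequence through the dense sets defines the value at (a, b), and the estimate
of the previous lemma shows that every other sequence has the same limit. *)
Lemma extension_exists (S1 : set V1) (S2 : set V2) f C :
  (forall x y, S1 x -> S1 y -> S1 (x - y)) ->
  (forall x y, S2 x -> S2 y -> S2 (x - y)) ->
  dense S1 -> dense S2 -> bounded_biadditive S1 S2 f C ->
  exists g, extends_by_limits S1 S2 f g.
Proof.
move=> S1B S2B d1 d2 fC.
have lim_ex (ab : V1 * V2) : exists l : V3, forall u v, (forall i, S1 (u i)) ->
    (forall i, S2 (v i)) -> u @ \oo --> ab.1 -> v @ \oo --> ab.2 ->
    (fun i => f (u i) (v i)) @ \oo --> l.
  case: ab => a b /=.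
  have [u0 Su0 /rcvgP ua0] := dense_seq a d1.
  have [v0 Sv0 /rcvgP vb0] := dense_seq b d2.
  have /cvg_ex[l /rcvgP hl] : cvgn (fun i => f (u0 i) (v0 i)).
    apply: rcauchy_cvg => eps e0.
    have [d d0 hd] := bounded_biadditive_dist a b S1B S2B fC e0.
    have [N1 h1] := ua0 _ d0; have [N2 h2] := vb0 _ d0.
    exists (N1 + N2)%N => p q Np Nq; apply: hd => //;
      solve [apply: h1; apply: leq_trans Np; exact: leq_addr
            |apply: h1; apply: leq_trans Nq; exact: leq_addr
            |apply: h2; apply: leq_trans Np; exact: leq_addl
            |apply: h2; apply: leq_trans Nq; exact: leq_addl].
  exists l => u v Su Sv /rcvgP ua /rcvgP vb; apply/rcvgP => eps e0.
  have [|d d0 hd] := bounded_biadditive_dist a b S1B S2B fC (eps := eps / 2); first lra.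
  have [N1 h1] := ua0 _ d0; have [N2 h2] := vb0 _ d0.
  have [N3 h3] := ua _ d0; have [N4 h4] := vb _ d0.
  have [|N5 h5] := hl (eps / 2); first lra.
  exists (N1 + N2 + N3 + N4 + N5)%N => p Np.
  rewrite -(subrK (f (u0 p) (v0 p)) (f (u p) (v p))) -addrA.
  have := hd (u p) (u0 p) (v p) (v0 p) (Su p) (Su0 p) (Sv p) (Sv0 p)
    (h3 p ltac:(lia)) (h1 p ltac:(lia)) (h4 p ltac:(lia)) (h2 p ltac:(lia)).
  have := h5 p ltac:(lia).
  have := rnormD (f (u p) (v p) - f (u0 p) (v0 p)) (f (u0 p) (v0 p) - l).
  lra.
have [g hg] := choice lim_ex.
by exists (fun a b => g (a, b)) => a b u v Su Sv; apply: (hg (a, b)).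
Qed.

Lemma extends_eq (S1 : set V1) (S2 : set V2) f g x y :
  extends_by_limits S1 S2 f g -> S1 x -> S2 y -> g x y = f x y.
Proof.
move=> fg Sx Sy.
apply: (@cvgn_unique _ (fun=> f x y)); last exact: cvg_cst.
by apply: (fg x y (fun=> x) (fun=> y)) => //; exact: cvg_cst.
Qed.

End Extension.

Lemma bounded_biadditive_cvg (R : realType) (V1 V2 : normedModType R[i])
    (V3 : completeNormedModType R[i]) (f : V1 -> V2 -> V3) C :
  bounded_biadditive setT setT f C -> extends_by_limits setT setT f f.
Proof.
move=> fC.
have [//|//|g hg] := extension_exists _ _ (@dense_setT R V1) (@dense_setT R V2) fC.
move=> a b u v Su Sv ua vb; rewrite -(extends_eq hg) //.
exact: hg.
Qed.

(** * Algebra-valued inner products *)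

Section SubspaceTheory.
Context {K : numFieldType} {V : lmodType K} {S : set V}.
Hypothesis HS : subspace S.

Lemma subspace0 : S 0.
Proof. exact: HS.1. Qed.

Lemma subspaceD x y : S x -> S y -> S (x + y).
Proof. by move=> Sx Sy; rewrite -[x]scale1r; apply: HS.2. Qed.

Lemma subspaceZ z x : S x -> S (z *: x).
Proof. by move=> Sx; rewrite -[_ *: _]addr0; exact: HS.2 _ _ _ Sx HS.1. Qed.

Lemma subspaceN x : S x -> S (- x).
Proof. by move=> Sx; rewrite -scaleN1r; apply: subspaceZ. Qed.

Lemma subspaceB x y : S x -> S y -> S (x - y).
Proof. by move=> Sx Sy; apply: subspaceD => //; apply: subspaceN. Qed.

End SubspaceTheory.

Section HermitianForms.
Context {R : realType} {A : cstarAlgType R}.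

(** An algebra-valued inner product without the module structure.  A left inner
product is one; a right inner product is one after exchanging its arguments. *)
Record positive_form (V : lmodType R[i]) (X : set V) (s : V -> V -> A) : Prop := {
  pf_subspace : subspace X;
  pfDl : forall x y z, X x -> X y -> X z -> s (x + y) z = s x z + s y z;
  pfZl : forall (c : R[i]) x y, X x -> X y -> s (c *: x) y = c *: s x y;
  pf_adj : forall x y, X x -> X y -> s x y = adj (s y x);
  pf_pos : forall x, X x -> cpos (s x x)
}.

Lemma conjcN (c : R[i]) : Num.conj (- c) = - Num.conj c.
Proof. exact: rmorphN. Qed.

Lemma conjc_1 : Num.conj (1 : R[i]) = 1.
Proof. exact: rmorph1. Qed.

Lemma scaler_real2 (V : lmodType R[i]) (x : V) : (2 : R)%:C *: x = x + x.
Proof.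
rewrite -{2 3}(scale1r x) -scalerDl; congr (_ *: _).
by apply/eqP; rewrite eq_complex /= addr0 !eqxx.
Qed.

Section Polarization.
Context {V : lmodType R[i]} {X : set V} {s : V -> V -> A}.
Hypothesis Hs : positive_form X s.
Let XS := pf_subspace Hs.

Lemma pfDr x y z : X x -> X y -> X z -> s x (y + z) = s x y + s x z.
Proof.
move=> Xx Xy Xz; have Xyz := subspaceD XS Xy Xz.
by rewrite (pf_adj Hs) // (pfDl Hs) // adjD -!(pf_adj Hs).
Qed.

Lemma pfZr (c : R[i]) x y : X x -> X y -> s x (c *: y) = Num.conj c *: s x y.
Proof.
move=> Xx Xy; have Xcy := subspaceZ XS c Xy.
by rewrite (pf_adj Hs) // (pfZl Hs) // adjZ -(pf_adj Hs).
Qed.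

Lemma pf_square (c : R[i]) x y : X x -> X y ->
  s (x + c *: y) (x + c *: y) =
  s x x + (c * Num.conj c) *: s y y + (c *: s y x + Num.conj c *: s x y).
Proof.
move=> Xx Xy; have Xcy := subspaceZ XS c Xy; have Xxy := subspaceD XS Xx Xcy.
rewrite (pfDl Hs) // !pfDr // (pfZl Hs) // !pfZr // (pfZl Hs) // scalerA.
rewrite [Num.conj c * _]mulrC.
by rewrite [_ + (c * _) *: _]addrC addrACA [Num.conj c *: _ + _]addrC.
Qed.

(** A weak Cauchy-Schwarz inequality.  By polarization 4 s(x, y) is the combination
of s(x + c y, x + c y) for the four fourth roots of unity c, and each of these
lies below their sum over c and - c, which is 2 s(x, x) + 2 s(y, y). *)
Lemma pf_bound x y : X x -> X y ->
  rnorm (s x y) <= 2 * (rnorm (s x x) + rnorm (s y y)).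
Proof.
move=> Xx Xy.
pose q (c : R[i]) := s (x + c *: y) (x + c *: y).
have q0 c : cpos (q c).
  by apply: (pf_pos Hs); apply: (subspaceD XS) => //; apply: subspaceZ.
pose T := rnorm (s x x) + rnorm (s y y).
have qT c : c * Num.conj c = 1 -> rnorm (q c) <= 2 * T.
  move=> c1.
  have E : q c + q (- c) = (2 : R)%:C *: (s x x + s y y).
    rewrite /q !pf_square // conjcN mulrNN c1 scale1r !scaleNr -opprD.
    by rewrite addrACA subrr addr0 scaler_real2.
  have : rnorm (q c) <= rnorm (q c + q (- c)).
    by apply: cle_rnorm => //; rewrite /cle addrC addKr.
  rewrite E rnormZr ger0_norm //.
  by have := rnormD (s x x) (s y y); rewrite /T; lra.
have ci : 'i * Num.conj 'i = 1 :> R[i].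
  by rewrite conjc_i mulrN -expr2 sqr_i opprK.
have E4 : (4 : R)%:C *: s x y = (q 1 - q (- 1)) + 'i *: (q 'i - q (- 'i)).
  have D c : c * Num.conj c = 1 ->
      q c - q (- c) = (2 : R)%:C *: (c *: s y x + Num.conj c *: s x y).
    move=> c1; rewrite /q !pf_square // conjcN mulrNN !scaleNr -opprD.
    by rewrite opprB addrC addrA subrK scaler_real2.
  rewrite (D 1) ?conjc_1 ?mulr1 // (D 'i) // conjc_i !scale1r.
  have Ei : 'i *: ('i *: s y x + - 'i *: s x y) = s x y - s y x :> A.
    by rewrite scalerDr !scalerA mulrN -expr2 sqr_i opprK scaleN1r scale1r addrC.
  rewrite [in RHS]scalerA ['i * _]mulrC -scalerA Ei -scalerDr [s y x + _]addrC.
  rewrite addrACA subrr addr0 -scaler_real2 scalerA -rmorphM.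
  by congr (_%:C *: _); lra.
have : rnorm ((4 : R)%:C *: s x y) <= 8 * T.
  rewrite E4; apply: le_trans (rnormD _ _) _.
  rewrite rnormZ.
  have -> : cmod 'i = 1 :> R by rewrite /cmod normc_def /= expr0n expr1n add0r sqrtr1.
  have h1 := rnormB (q 1) (q (-1)); have h2 := rnormB (q 'i) (q (- 'i)).
  have k1 := qT 1; have k2 := qT (-1); have k3 := qT 'i ci; have k4 := qT (- 'i).
  have {}k1 : rnorm (q 1) <= 2 * T by apply: k1; rewrite conjc_1 mulr1.
  have {}k2 : rnorm (q (-1)) <= 2 * T.
    by apply: k2; rewrite conjcN mulrNN conjc_1 mulr1.
  have {}k4 : rnorm (q (- 'i)) <= 2 * T by apply: k4; rewrite conjcN mulrNN.
  lra.
by rewrite rnormZr ger0_norm //; rewrite /T; lra.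
Qed.

End Polarization.

(** Homogeneity reduces the claim to vectors of norm 1. *)
Lemma pf_norm_bound (V : normedModType R[i]) (X : set V) (s : V -> V -> A) (K : R) :
  positive_form X s -> (forall x, X x -> rnorm x = 1 -> rnorm (s x x) <= K) ->
  forall x y, X x -> X y -> rnorm (s x y) <= 4 * K * (rnorm x * rnorm y).
Proof.
move=> Hs HK x y Xx Xy; have XS := pf_subspace Hs.
have [/rnorm_eq0 x0|x0] := eqVneq (rnorm x) 0.
  by rewrite x0 -(scale0r 0) (pfZl Hs) ?scale0r ?rnorm0 ?mul0r ?mulr0 //; exact: subspace0.
have [/rnorm_eq0 y0|y0] := eqVneq (rnorm y) 0.
  rewrite y0 -(scale0r 0) (pfZr Hs) ?rmorph0 ?scale0r ?rnorm0 ?mulr0 //; exact: subspace0.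
have nx : 0 < rnorm x by rewrite lt_neqAle eq_sym x0 rnorm_ge0.
have ny : 0 < rnorm y by rewrite lt_neqAle eq_sym y0 rnorm_ge0.
pose x' := (rnorm x)^-1%:C *: x; pose y' := (rnorm y)^-1%:C *: y.
have Xx' : X x' by apply: subspaceZ.
have Xy' : X y' by apply: subspaceZ.
have x'1 : rnorm x' = 1 by rewrite rnormZr gtr0_norm ?invr_gt0 // mulVf.
have y'1 : rnorm y' = 1 by rewrite rnormZr gtr0_norm ?invr_gt0 // mulVf.
have := pf_bound Hs Xx' Xy'; have := HK _ Xx' x'1; have := HK _ Xy' y'1.
have -> : rnorm (s x' y') = (rnorm x)^-1 * ((rnorm y)^-1 * rnorm (s x y)).
  rewrite (pfZl Hs) // (pfZr Hs) // conjc_rc !rnormZr.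
  by rewrite !gtr0_norm ?invr_gt0.
move=> h1 h2 h3.
have : (rnorm x)^-1 * ((rnorm y)^-1 * rnorm (s x y)) <= 4 * K by lra.
by rewrite ler_pdivrMl // ler_pdivrMl // [leRHS]mulrA mulrC [rnorm y * _]mulrC.
Qed.

End HermitianForms.

(** * The Morita context on the closures *)

Section SequenceLimits.
Context {R : realType}.

Lemma seq_lim_eq (V : normedModType R[i]) (u v : nat -> V) (a b : V) :
  u @ \oo --> a -> v @ \oo --> b -> u =1 v -> a = b.
Proof. by move=> ua vb /funext uv; apply: cvgn_unique ua _; rewrite uv. Qed.

Lemma seq_limD (V : normedModType R[i]) (u v : nat -> V) (a b : V) :
  u @ \oo --> a -> v @ \oo --> b -> (fun i => u i + v i) @ \oo --> a + b.
Proof. by move=> ua vb; apply: cvgD. Qed.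

Lemma seq_limZ (V : normedModType R[i]) (z : R[i]) (u : nat -> V) (a : V) :
  u @ \oo --> a -> (fun i => z *: u i) @ \oo --> z *: a.
Proof. by move=> ua; apply: cvgZ => //; exact: cvg_cst. Qed.

Lemma seq_limB (V : normedModType R[i]) (u v : nat -> V) (a b : V) :
  u @ \oo --> a -> v @ \oo --> b -> (fun i => u i - v i) @ \oo --> a - b.
Proof. by move=> ua vb; apply: cvgB. Qed.

Lemma seq_lim_norm2Z (V W : normedModType R[i]) (u : nat -> V) (v : nat -> W) a b :
  u @ \oo --> a -> v @ \oo --> b ->
  (fun i => `|u i| ^+ 2 *: v i) @ \oo --> `|a| ^+ 2 *: b.
Proof.
move=> ua vb; apply: cvgZ => //.
by rewrite expr2; under eq_fun do rewrite expr2; apply: cvgM; apply: cvg_norm.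
Qed.

Lemma seq_lim_adj (A : cstarAlgType R) (u : nat -> A) (a : A) :
  u @ \oo --> a -> (fun i => adj (u i)) @ \oo --> adj a.
Proof.
move=> /rcvgP ua; apply/rcvgP => e /ua[N hN]; exists N => p Np.
by rewrite -adjB rnorm_adj hN.
Qed.

Lemma cmul_bounded (A : cstarAlgType R) :
  bounded_biadditive setT setT (@cmul R A) 1.
Proof.
split=> [x x' y _ _ _|x y y' _ _ _|x y _ _].
- by rewrite cmulDl cmulNr.
- by rewrite cmulDr cmulrN.
- by rewrite mul1r rnormM.
Qed.

Lemma seq_limM (A : cstarAlgType R) (u v : nat -> A) (a b : A) :
  u @ \oo --> a -> v @ \oo --> b -> (fun i => cmul (u i) (v i)) @ \oo --> cmul a b.
Proof. exact: (bounded_biadditive_cvg (cmul_bounded A)). Qed.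

Lemma positive_form_bounded (A : cstarAlgType R) (V : normedModType R[i])
    (X : set V) (s : V -> V -> A) (K : R) :
  positive_form X s -> (forall x, X x -> rnorm x = 1 -> rnorm (s x x) <= K) ->
  bounded_biadditive X X s (4 * K).
Proof.
move=> Hs HK; have XS := pf_subspace Hs.
split=> [x x' y Xx Xx' Xy|x y y' Xx Xy Xy'|]; last exact: pf_norm_bound.
  rewrite (pfDl Hs) //; last exact: subspaceN.
  by rewrite -scaleN1r (pfZl Hs) // scaleN1r.
rewrite (pfDr Hs) //; last exact: subspaceN.
by rewrite -scaleN1r (pfZr Hs) // conjcN conjc_1 scaleN1r.
Qed.

End SequenceLimits.

Section HilbertModule.
Context {R : realType} {B : cstarAlgType R} {E : completeNormedModType R[i]}.
Context {ract : E -> B -> E} {rip : E -> E -> B}.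
Hypothesis EH : hilbert_module ract rip.
Let EM := EH.1.

Lemma rnorm_rip e : rnorm e ^+ 2 = rnorm (rip e e).
Proof.
by apply: complexI; rewrite -rnormE -EH.2 rnormE rmorphXn.
Qed.

Lemma rip_positive_form : positive_form setT (fun x y => rip y x).
Proof.
split.
- exact: rim_subspace EM.
- by move=> x y z _ _ _; apply: (ripDr EM).
- by move=> c x y _ _; apply: (ripZr EM).
- by move=> x y _ _; apply: (rip_adj EM).
- by move=> x _; apply: (rip_pos EM).
Qed.

Lemma rip_bounded : bounded_biadditive setT setT rip 4.
Proof.
have [|h1 h2 h3] := positive_form_bounded (K := 1) rip_positive_form.
  by move=> x _ x1; rewrite -rnorm_rip x1 expr1n.
split=> [x x' y _ _ _|x y y' _ _ _|x y _ _]; rewrite ?h1 ?h2 //.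
by rewrite [rnorm x * _]mulrC -[4]mulr1 h3.
Qed.

Lemma seq_lim_rip (u v : nat -> E) a b : u @ \oo --> a -> v @ \oo --> b ->
  (fun i => rip (u i) (v i)) @ \oo --> rip a b.
Proof. exact: (bounded_biadditive_cvg rip_bounded). Qed.

Lemma rip_actl e f b : rip (ract e b) f = cmul (adj b) (rip e f).
Proof.
by rewrite (rip_adj EM) // (rip_act EM) // adjM -(rip_adj EM).
Qed.

Lemma ract_bounded : bounded_biadditive setT setT ract 1.
Proof.
split=> [x x' y _ _ _|x y y' _ _ _|x y _ _].
- rewrite (ractDl EM) // -[in LHS]scaleN1r (ractZl EM) // scaleN1r //.
- rewrite (ractDr EM) // -[in LHS]scaleN1r (ractZr EM) // scaleN1r //.
rewrite mul1r -[leLHS]ger0_norm ?rnorm_ge0 // -[leRHS]ger0_norm ?mulr_ge0 ?rnorm_ge0 //.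
rewrite -!sqrtr_sqr ler_sqrt ?sqr_ge0 //.
rewrite rnorm_rip rip_actl (rip_act EM) //.
apply: le_trans (rnormM _ _) _; rewrite rnorm_adj.
apply: le_trans (ler_wpM2l (rnorm_ge0 y) (rnormM _ _)) _.
by rewrite -rnorm_rip exprMn mulrCA expr2.
Qed.

Lemma seq_lim_ract (u : nat -> E) (v : nat -> B) a b : u @ \oo --> a ->
  v @ \oo --> b -> (fun i => ract (u i) (v i)) @ \oo --> ract a b.
Proof. exact: (bounded_biadditive_cvg ract_bounded). Qed.

(** (e|e)^2 = (e | e (e|e)) = 0. *)
Lemma ract_rip_eq0 e : ract e (rip e e) = 0 -> e = 0.
Proof.
move=> e0; apply: (rip_def EM) => //; apply: cstar_eq0.
have rip0 : rip e 0 = 0 by rewrite -(scale0r 0) (ripZr EM) ?scale0r.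
by rewrite -(rip_adj EM) // -(rip_act EM) // e0.
Qed.

End HilbertModule.

Section DensityExtension.
Context {R : realType} {A B : cstarAlgType R} {E : completeNormedModType R[i]}.
Context {SA : set A} {SB : set B} {X : set E}.
Context {lact : A -> E -> E} {ract : E -> B -> E}.
Context {lip : E -> E -> A} {rip : E -> E -> B}.
Hypothesis EH : hilbert_module ract rip.
Hypothesis Xd : dense X.
Hypothesis XM : pre_morita SA SB X lact ract lip rip.
Let EM := EH.1.
Let XL := pm_left XM.
Let XR := pm_right XM.
Let XS := rim_subspace XR.
Let SAS := dss_subspace (pm_subalgA XM).
Let SBS := dss_subspace (pm_subalgB XM).
Let SAd := dss_dense (pm_subalgA XM).
Let SBd := dss_dense (pm_subalgB XM).

Lemma lip_positive_form : positive_form X lip.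
Proof.
split.
- exact: XS.
- exact: lipDl XL.
- exact: lipZl XL.
- exact: lip_adj XL.
- exact: lip_pos XL.
Qed.

Lemma lact_bounded : bounded_biadditive SA X lact 1.
Proof.
split=> [x x' y Sx Sx' Xy|x y y' Sx Xy Xy'|x y Sx Xy].
- rewrite (lactDl XL) //; last exact: subspaceN.
  by rewrite -[in LHS]scaleN1r (lactZl XL) // scaleN1r.
- rewrite (lactDr XL) //; last exact: subspaceN.
  by rewrite -[in LHS]scaleN1r (lactZr XL) // scaleN1r.
rewrite mul1r -[leLHS]ger0_norm ?rnorm_ge0 // -[leRHS]ger0_norm ?mulr_ge0 ?rnorm_ge0 //.
rewrite -!sqrtr_sqr ler_sqrt ?sqr_ge0 //.
rewrite (rnorm_rip EH) exprMn (rnorm_rip EH y).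
have -> : rnorm x ^+ 2 * rnorm (rip y y) = rnorm (`|x| ^+ 2 *: rip y y).
  by rewrite rnormE -rmorphXn rnormZr ger0_norm // exprn_ge0 // rnorm_ge0.
apply: cle_rnorm; last exact: (pm_bound_right XM).
by apply: (rip_pos EM).
Qed.

(** The two norms on the bimodule are comparable.  For |e| = 1 put x = (e|e) on the
left and b = (e|e) on the right.  Then x^2 is the left inner product of x e = e b
with e, so that |x|^2 <= 2 (|x| + |x|) by the weak Cauchy-Schwarz inequality and
the bound on the right action.  Hence |x| <= 4, and polarization costs another
factor 4. *)
Lemma lip_bounded : bounded_biadditive X X lip 16.
Proof.
have -> : (16 : R) = 4 * 4 by lra.
apply: positive_form_bounded lip_positive_form _ => e Xe e1.
set b := rip e e; have b1 : rnorm b = 1 by rewrite -(rnorm_rip EH) e1 expr1n.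
have Sb : SB b by apply: (rip_in XR).
set x := lip e e; have x0 := rnorm_ge0 x.
have Xeb : X (ract e b) by apply: (ract_in XR).
have E1 : rnorm x ^+ 2 = rnorm (lip (ract e b) e).
  rewrite -rnorm_cstar (cpos_sa (lip_pos XL Xe)) -/x.
  rewrite /b -(pm_compat XM) // (lip_act XL) //; exact: (lip_in XL).
have h1 := pf_bound lip_positive_form Xeb Xe.
have h2 : rnorm (lip (ract e b) (ract e b)) <= rnorm x.
  have := pm_bound_left XM Xe Sb; rewrite rnormE b1 expr1n scale1r.
  by apply: cle_rnorm; apply: (lip_pos XL).
rewrite -E1 -/x in h1.
by have [] := eqVneq (rnorm x) 0; nra.
Qed.

(** The left action and the left inner product extend to all of [A] and [E], and the
closures form a Morita context.  Identities pass to the limit as identities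
between limits of sequences; positivity and the two operator inequalities
pass to the limit because the positive cone is closed; definiteness of the
left inner product follows from compatibility with the right one. *)
Lemma total_morita : exists (lact' : A -> E -> E) (lip' : E -> E -> A),
  [/\ extends_by_limits SA X lact lact', extends_by_limits X X lip lip'
    & pre_morita setT setT setT lact' ract lip' rip].
Proof.
have XB x y : X x -> X y -> X (x - y) by exact: subspaceB.
have SAB x y : SA x -> SA y -> SA (x - y) by exact: subspaceB.
have [L HL] := extension_exists SAB XB SAd Xd lact_bounded.
have [P HP] := extension_exists XB XB Xd Xd lip_bounded.
have LB (a : A) : exists2 u : nat -> A, (forall i, SA (u i)) & u @ \oo --> a by exact: dense_seq.
have LX (a : E) : exists2 u : nat -> E, (forall i, X (u i)) & u @ \oo --> a by exact: dense_seq.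
have LSB (a : B) : exists2 u : nat -> B, (forall i, SB (u i)) & u @ \oo --> a by exact: dense_seq.
have compat e f g : L (P e f) g = ract e (rip f g).
  have [u Xu ue] := LX e; have [v Xv vf] := LX f; have [w Xw wg] := LX g.
  apply: (seq_lim_eq (u := fun i => lact (lip (u i) (v i)) (w i))).
  - by apply: HL => // [i|]; [exact: (lip_in XL)|exact: HP].
  - by apply: seq_lim_ract EH _ _ _ _ ue _; exact: seq_lim_rip EH _ _ _ _ vf wg.
  - by move=> i; apply: (pm_compat XM).
have PX e f : X e -> X f -> P e f = lip e f by move=> *; exact: extends_eq HP _ _.
exists L, P; split=> //; split.
- by split=> //; exact: dense_setT.
- by split=> //; exact: dense_setT.
- split=> //.
  + move=> a b e _ _ _.
    have [u Su ua] := LB a; have [v Sv vb] := LB b; have [w Xw we] := LX e.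
    apply: (seq_lim_eq (u := fun i => lact (u i + v i) (w i))).
    * apply: HL => // [i|]; [exact: subspaceD|exact: seq_limD].
    * exact: seq_limD (HL _ _ _ _ Su Xw ua we) (HL _ _ _ _ Sv Xw vb we).
    * by move=> i; apply: (lactDl XL).
  + move=> a e f _ _ _.
    have [u Su ua] := LB a; have [v Xv ve] := LX e; have [w Xw wf] := LX f.
    apply: (seq_lim_eq (u := fun i => lact (u i) (v i + w i))).
    * apply: HL => // [i|]; [exact: subspaceD|exact: seq_limD].
    * exact: seq_limD (HL _ _ _ _ Su Xv ua ve) (HL _ _ _ _ Su Xw ua wf).
    * by move=> i; apply: (lactDr XL).
  + move=> z a e _ _.
    have [u Su ua] := LB a; have [v Xv ve] := LX e.
    apply: (seq_lim_eq (u := fun i => lact (z *: u i) (v i))).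
    * apply: HL => // [i|]; [exact: subspaceZ|exact: seq_limZ].
    * exact: seq_limZ (HL _ _ _ _ Su Xv ua ve).
    * by move=> i; apply: (lactZl XL).
  + move=> z a e _ _.
    have [u Su ua] := LB a; have [v Xv ve] := LX e.
    apply: (seq_lim_eq (u := fun i => lact (u i) (z *: v i))).
    * apply: HL => // [i|]; [exact: subspaceZ|exact: seq_limZ].
    * exact: seq_limZ (HL _ _ _ _ Su Xv ua ve).
    * by move=> i; apply: (lactZr XL).
  + move=> a b e _ _ _.
    have [u Su ua] := LB a; have [v Sv vb] := LB b; have [w Xw we] := LX e.
    apply: (seq_lim_eq (u := fun i => lact (cmul (u i) (v i)) (w i))).
    * apply: HL => // [i|]; [exact: (dss_mul (pm_subalgA XM))|exact: seq_limM].
    * have vw := HL _ _ _ _ Sv Xw vb we.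
      apply: HL Su _ ua vw => i; exact: (lact_in XL).
    * by move=> i; apply: (lactM XL).
  + move=> e f g _ _ _.
    have [u Su ua] := LX e; have [v Sv vb] := LX f; have [w Xw we] := LX g.
    apply: (seq_lim_eq (u := fun i => lip (u i + v i) (w i))).
    * apply: HP => // [i|]; [exact: subspaceD|exact: seq_limD].
    * exact: seq_limD (HP _ _ _ _ Su Xw ua we) (HP _ _ _ _ Sv Xw vb we).
    * by move=> i; apply: (lipDl XL).
  + move=> z e f _ _.
    have [u Su ua] := LX e; have [v Xv ve] := LX f.
    apply: (seq_lim_eq (u := fun i => lip (z *: u i) (v i))).
    * apply: HP => // [i|]; [exact: subspaceZ|exact: seq_limZ].
    * exact: seq_limZ (HP _ _ _ _ Su Xv ua ve).
    * by move=> i; apply: (lipZl XL).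
  + move=> e f _ _.
    have [u Su ua] := LX e; have [v Xv ve] := LX f.
    apply: (seq_lim_eq (u := fun i => lip (u i) (v i))).
    * exact: HP.
    * exact: seq_lim_adj (HP _ _ _ _ Xv Su ve ua).
    * by move=> i; apply: (lip_adj XL).
  + move=> a e f _ _ _.
    have [u Su ua] := LB a; have [v Xv ve] := LX e; have [w Xw wf] := LX f.
    apply: (seq_lim_eq (u := fun i => lip (lact (u i) (v i)) (w i))).
    * apply: HP => // [i|]; [exact: (lact_in XL)|exact: HL].
    * exact: seq_limM ua (HP _ _ _ _ Xv Xw ve wf).
    * by move=> i; apply: (lip_act XL).
  + move=> e _; have [u Xu ue] := LX e.
    apply: (cpos_closed (u := fun i => lip (u i) (u i))); last exact: HP.
    by move=> i; apply: (lip_pos XL).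
  + move=> e _ Pe; apply: (ract_rip_eq0 EH); rewrite -compat Pe.
    have [u Xu ue] := LX e.
    apply: (seq_lim_eq (u := fun i => lact 0 (u i))).
    * by apply: HL => // [i|]; [exact: subspace0|exact: cvg_cst].
    * exact: (cvg_cst 0).
    * by move=> i; rewrite -(scale0r 0) (lactZl XL) ?scale0r //; exact: subspace0.
- exact: EM.
- move=> a e b _ _ _.
  have [u Su ua] := LB a; have [v Xv ve] := LX e; have [w Sw wb] := LSB b.
  apply: (seq_lim_eq (u := fun i => ract (lact (u i) (v i)) (w i))).
  + by apply: seq_lim_ract EH _ _ _ _ _ wb; exact: HL.
  + exact: HL _ _ _ _ Su (fun i => ract_in XR (Xv i) (Sw i)) ua (seq_lim_ract EH ve wb).
  + by move=> i; apply: (pm_assoc XM).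
- apply: dense_mono (pm_full_left XM); apply: lspan_mono => _ [e [f [Xe Xf ->]]].
  by exists e, f; rewrite PX.
- apply: dense_mono (pm_full_right XM); apply: lspan_mono => _ [e [f [Xe Xf ->]]].
  by exists e, f.
- move=> e b _ _; have [v Xv ve] := LX e; have [w Sw wb] := LSB b.
  have vw := seq_lim_ract EH ve wb.
  have Xvw i : X (ract (v i) (w i)) by apply: (ract_in XR).
  apply: (cpos_closed (u := fun i => `|w i| ^+ 2 *: lip (v i) (v i)
      - lip (ract (v i) (w i)) (ract (v i) (w i)))).
    by move=> i; exact: (pm_bound_left XM).
  exact: seq_limB (seq_lim_norm2Z wb (HP _ _ _ _ Xv Xv ve ve))
    (HP _ _ _ _ Xvw Xvw vw vw).
- move=> a e _ _; have [u Su ua] := LB a; have [v Xv ve] := LX e.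
  have uv := HL _ _ _ _ Su Xv ua ve.
  apply: (cpos_closed (u := fun i => `|u i| ^+ 2 *: rip (v i) (v i)
      - rip (lact (u i) (v i)) (lact (u i) (v i)))).
    by move=> i; exact: (pm_bound_right XM).
  exact: seq_limB (seq_lim_norm2Z ua (seq_lim_rip EH ve ve)) (seq_lim_rip EH uv uv).
- by move=> e f g _ _ _; exact: compat.
Qed.

End DensityExtension.

(** * Convergence of derivatives and the completions *)

Definition dword (U : Type) (W : Type) (F : U -> W -> W) (w : seq U) (x : W) : W :=
  foldr F x w.

Section Words.
Context {T : eqType} {V : Type} {S : set V} {D : T -> V -> V}.
Hypothesis D_in : forall j x, S x -> S (D j x).
Hypothesis D_comm : forall j k x, S x -> D j (D k x) = D k (D j x).

Lemma dword_in w x : S x -> S (dword D w x).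
Proof. by move=> Sx; elim: w => //= j w IH; apply: D_in. Qed.

Lemma dword_comm w j x : S x -> dword D w (D j x) = D j (dword D w x).
Proof. by move=> Sx; elim: w => //= k w ->; rewrite D_comm //; exact: dword_in. Qed.

Lemma dword_perm w w' x : S x -> perm_eq w w' -> dword D w x = dword D w' x.
Proof.
move=> Sx; elim: w w' => [|j w IH] w' ww'.
  by move: ww'; rewrite perm_sym => /perm_nilP ->.
have jw' : j \in w' by rewrite -(perm_mem ww') mem_head.
case/splitPr: jw' ww' => w1 w2; rewrite perm_sym perm_catC /= perm_cons perm_catC.
rewrite perm_sym => /IH E; rewrite /= E.
by rewrite /dword !foldr_cat /= -!/(dword D _ _) dword_comm //; exact: dword_in.
Qed.

End Words.

Section MultiIndices.
Context {d k : nat}.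
Implicit Types alpha : {ffun 'I_d -> 'I_k.+1}.

Definition index_word alpha : seq 'I_d :=
  flatten [seq nseq (alpha i) i | i <- enum 'I_d].

Lemma mpower_word (V : Type) (D : 'I_d -> V -> V) alpha x :
  mpower D alpha x = dword D (index_word alpha) x.
Proof.
rewrite /mpower /index_word; elim: (enum 'I_d) => //= i s ->.
rewrite /dword foldr_cat; set y := foldr D x _.
by elim: (nat_of_ord (alpha i)) => //= n ->.
Qed.

Lemma size_index_word alpha : size (index_word alpha) = msize alpha.
Proof.
rewrite /index_word size_flatten /shape -map_comp sumnE big_map /msize big_enum.
by apply: eq_bigr => i _; rewrite /= size_nseq.
Qed.

Lemma index_word_count (w : seq 'I_d) : (size w <= k)%N ->
  perm_eq w (index_word [ffun i => inord (count_mem i w)]).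
Proof.
move=> wk; apply/allP => j _ /=; apply/eqP.
rewrite /index_word count_flatten -map_comp sumnE big_map big_enum /=.
rewrite (bigD1 j) //= big1 ?addn0 => [|i ij].
  rewrite count_nseq /= eqxx mul1n ffunE inordK // ltnS.
  exact: leq_trans (count_size _ _) wk.
by rewrite count_nseq /= (negbTE ij) mul0n.
Qed.

End MultiIndices.

Record derivation_family (R : realType) (V : normedModType R[i]) (d : nat)
    (S : set V) (D : 'I_d -> V -> V) : Prop := {
  df_subspace : subspace S;
  df_in : forall j x, S x -> S (D j x);
  df_linear : forall j, linear_on S (D j);
  df_comm : forall j k x, S x -> D j (D k x) = D k (D j x)
}.

Section Jets.
Context {R : realType} {d : nat}.

(** All iterated derivatives of [u] of order at most [m] converge.  Compared with
the seminorms, this recursive form is adapted to the Leibniz rule, which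
differentiates once at a time and produces no binomial coefficients. *)
Fixpoint jet_cvg (V : normedModType R[i]) (D : 'I_d -> V -> V) (m : nat)
    (u : nat -> V) : Prop :=
  cvgn u /\ if m is m'.+1 then forall j, jet_cvg D m' (fun i => D j (u i)) else True.

Section OneFamily.
Context {V : completeNormedModType R[i]} {S : set V} {D : 'I_d -> V -> V}.
Hypothesis HD : derivation_family S D.
Let SS := df_subspace HD.

Lemma df_linearD j x y : S x -> S y -> D j (x + y) = D j x + D j y.
Proof. by move=> Sx Sy; have := df_linear HD j 1 Sx Sy; rewrite !scale1r. Qed.

Lemma df_linear0 j : D j 0 = 0.
Proof.
have S0 := subspace0 SS.
by have := df_linearD j S0 S0; rewrite addr0 -{1}[D j 0]addr0 => /addrI.
Qed.

Lemma df_linearZ j z x : S x -> D j (z *: x) = z *: D j x.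
Proof.
move=> Sx; have := df_linear HD j z Sx (subspace0 SS).
by rewrite df_linear0 !addr0.
Qed.

Lemma jet_cvg_cvg m (u : nat -> V) : jet_cvg D m u -> cvgn u.
Proof. by case: m => [|m] []. Qed.

Lemma jet_cvgS m (u : nat -> V) : jet_cvg D m.+1 u -> jet_cvg D m u.
Proof.
elim: m u => [|m IH] u /= [cu ju]; first by split.
by split=> // j; apply: IH; exact: ju.
Qed.

Lemma jet_cvg_cst m x : jet_cvg D m (fun=> x).
Proof. by elim: m x => [|m IH] x /=; split=> //; exact: is_cvg_cst. Qed.

Lemma jet_cvgD m (u v : nat -> V) : (forall i, S (u i)) -> (forall i, S (v i)) ->
  jet_cvg D m u -> jet_cvg D m v -> jet_cvg D m (fun i => u i + v i).
Proof.
elim: m u v => [|m IH] u v Su Sv /= [cu ju] [cv jv].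
  by split=> //; exact: is_cvgD.
split=> [|j]; first exact: is_cvgD.
have -> : (fun i => D j (u i + v i)) = (fun i => D j (u i) + D j (v i)).
  by apply/funext => i; rewrite df_linearD.
by apply: IH => // i; apply: (df_in HD).
Qed.

Lemma jet_cvgZ m z (u : nat -> V) : (forall i, S (u i)) ->
  jet_cvg D m u -> jet_cvg D m (fun i => z *: u i).
Proof.
elim: m u => [|m IH] u Su /= [cu ju].
  by split=> //; apply: is_cvgZ => //; exact: is_cvg_cst.
split=> [|j]; first by apply: is_cvgZ => //; exact: is_cvg_cst.
have -> : (fun i => D j (z *: u i)) = (fun i => z *: D j (u i)).
  by apply/funext => i; rewrite df_linearZ.
by apply: IH => // i; apply: (df_in HD).
Qed.

Lemma jet_cvg_words m (u : nat -> V) : jet_cvg D m u <->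
  forall w, (size w <= m)%N -> cvgn (fun i => dword D w (u i)).
Proof.
elim: m u => [|m IH] u /=.
  split=> [[cu _] w|h]; last by split=> //; exact: (h [::]).
  by rewrite leqn0 size_eq0 => /eqP ->.
split=> [[cu ju] w|h].
  case/lastP: w => [//|w j]; rewrite size_rcons ltnS => wm.
  have -> : (fun i => dword D (rcons w j) (u i)) = (fun i => dword D w (D j (u i))).
    by apply/funext => i; rewrite /dword foldr_rcons.
  by have /IH := ju j; apply.
split=> [|j]; first exact: (h [::]).
apply/IH => w wm; have := h (rcons w j); rewrite size_rcons ltnS => /(_ wm).
by under eq_fun do rewrite /dword foldr_rcons.
Qed.

Lemma dword_linear w x y : S x -> S y ->
  dword D w (x - y) = dword D w x - dword D w y.
Proof.
move=> Sx Sy; elim: w => //= j w ->.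
have Sw z : S z -> S (dword D w z) by apply: dword_in; exact: (df_in HD).
have Sy' : S (- dword D w y) by apply: (subspaceN SS); exact: Sw.
by rewrite df_linearD //; [rewrite -scaleN1r df_linearZ ?scaleN1r //|]; exact: Sw.
Qed.

Lemma mfact_gt0 k (alpha : {ffun 'I_d -> 'I_k.+1}) : (0 < mfact alpha)%N.
Proof. by apply: prodn_gt0 => i; exact: fact_gt0. Qed.

Lemma seminorm_ge_term k (alpha : {ffun 'I_d -> 'I_k.+1}) x : (msize alpha <= k)%N ->
  `|mpower D alpha x| / (mfact alpha)%:R <= seminorm D k x.
Proof.
move=> ak; rewrite /seminorm (bigD1 alpha) //= lerDl.
by apply: sumr_ge0 => beta _; rewrite divr_ge0.
Qed.

(** The seminorm of order k dominates every derivative of order at most k up to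
the factor alpha!, and is a finite sum of such terms.  Completeness of the space
turns the Cauchy condition on the derivatives into convergence. *)
Lemma seminorm_cauchyP n (u : nat -> V) : (forall i, S (u i)) ->
  seminorm_cauchy D n u <-> forall m, le_order m n -> jet_cvg D m u.
Proof.
move=> Su; split=> [uC m mn|uJ k kn eps].
  apply/jet_cvg_words => w wm.
  pose alpha : {ffun 'I_d -> 'I_(size w).+1} := [ffun i => inord (count_mem i w)].
  have pw := index_word_count (leqnn (size w)).
  have ak : (msize alpha <= size w)%N by rewrite -size_index_word -(perm_size pw).
  have kn : le_order (size w) n.
    by case: n mn {uC} => //= n; exact: leq_trans.
  apply: rcauchy_cvg => e e0.
  have f0 : 0 < (mfact alpha)%:R :> R by rewrite ltr0n mfact_gt0.
  have [|N hN] := uC _ kn (e / (mfact alpha)%:R)%:C.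
    by rewrite ltcR divr_gt0.
  exists N => p q Np Nq; have := le_lt_trans (seminorm_ge_term (u p - u q) ak) (hN p q Np Nq).
  rewrite mpower_word -(dword_perm (df_in HD) (df_comm HD) _ pw); last exact: subspaceB.
  rewrite dword_linear // rmorphM /= fmorphV /= rmorph_nat ltr_pM2r ?invr_gt0 ?ltr0n ?mfact_gt0 //.
  by rewrite rnormE ltcR.
move=> /posC_real [-> e0]; set e := complex.Re eps in e0 *.
pose I := {ffun 'I_d -> 'I_k.+1}.
(* each of the at most #|I| terms of the seminorm is made smaller than e' *)
pose e' := e / (#|{: I}|.+1)%:R.
have e'0 : 0 < e' by rewrite divr_gt0 // ltr0n.
have hN (alpha : I) : exists N, (msize alpha <= k)%N -> forall p q, (N <= p)%N ->
    (N <= q)%N -> `|mpower D alpha (u p - u q)| / (mfact alpha)%:R <= e'%:C.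
  have [ak|_] := boolP (msize alpha <= k)%N; last by exists 0%N.
  have /jet_cvg_words/(_ (index_word alpha)) := uJ k kn.
  rewrite size_index_word => /(_ ak) /rcvg_cauchy /(_ _ e'0) [N hN].
  exists N => _ p q Np Nq.
  rewrite mpower_word dword_linear // ler_pdivrMr ?ltr0n ?mfact_gt0 //.
  apply: (@le_trans _ _ e'%:C); first by rewrite rnormE lecR ltW // hN.
  by rewrite ler_peMr ?ler0c ?(ltW e'0) // ler1n mfact_gt0.
have [N HN] := choice hN.
exists (\sum_(alpha : I) N alpha)%N => p q Np Nq.
have NN alpha : (N alpha <= \sum_(alpha : I) N alpha)%N.
  by rewrite (bigD1 alpha) //= leq_addr.
apply: (@le_lt_trans _ _ (\sum_(alpha : I | (msize alpha <= k)%N) e'%:C)).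
  apply: ler_sum => alpha ak; apply: (HN alpha ak).
    exact: leq_trans (NN _) Np.
  exact: leq_trans (NN _) Nq.
rewrite sumr_const -rmorphMn ltcR /e' -mulr_natr -mulrA gtr_pMr //.
rewrite mulrC ltr_pdivrMr ?ltr0n // mul1r ltr_nat ltnS.
exact: max_card.
Qed.

Lemma completionP n x : completion S D n x <-> exists u : nat -> V,
  [/\ forall i, S (u i), forall m, le_order m n -> jet_cvg D m u & u @ \oo --> x].
Proof.
split=> -[u [Su uC ux]]; exists u; split=> //; exact/(seminorm_cauchyP n Su).
Qed.

Lemma completion_sub n : S `<=` completion S D n.
Proof.
move=> x Sx; apply/completionP; exists (fun=> x); split=> //.
  by move=> m _; exact: jet_cvg_cst.
exact: cvg_cst.
Qed.

Lemma completion_subspace n : subspace (completion S D n).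
Proof.
split; first by apply: completion_sub; exact: subspace0.
move=> z x y /completionP [u [Su uJ ux]] /completionP [v [Sv vJ vy]].
have Szu i : S (z *: u i) by exact: subspaceZ.
apply/completionP; exists (fun i => z *: u i + v i); split.
- by move=> i; exact: subspaceD.
- by move=> m mn; apply: jet_cvgD => //; [apply: jet_cvgZ => //; exact: uJ|exact: vJ].
- by apply: seq_limD => //; exact: seq_limZ.
Qed.

End OneFamily.

Section Leibniz.
Context {V1 V2 V3 : completeNormedModType R[i]}.
Context {S1 : set V1} {S2 : set V2} {S3 : set V3}.
Context {D1 : 'I_d -> V1 -> V1} {D2 : 'I_d -> V2 -> V2} {D3 : 'I_d -> V3 -> V3}.
Hypothesis H1 : derivation_family S1 D1.
Hypothesis H2 : derivation_family S2 D2.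
Hypothesis H3 : derivation_family S3 D3.
Context {f g : V1 -> V2 -> V3} {s1 s2 : R[i]}.
Hypothesis f_in : forall x y, S1 x -> S2 y -> S3 (f x y).
Hypothesis f_leibniz : forall j x y, S1 x -> S2 y ->
  D3 j (f x y) = s1 *: f (D1 j x) y + s2 *: f x (D2 j y).
Hypothesis fg : extends_by_limits S1 S2 f g.

(** Induction on the order: a derivative of f(u, v) is a combination of f(Du, v) and
f(u, Dv), and both pairs have convergent derivatives up to the smaller order. *)
Lemma jet_cvg_leibniz m u v : (forall i, S1 (u i)) -> (forall i, S2 (v i)) ->
  jet_cvg D1 m u -> jet_cvg D2 m v -> jet_cvg D3 m (fun i => f (u i) (v i)).
Proof.
elim: m u v => [|m IH] u v Su Sv ju jv.
  split=> //; have /cvg_ex[a ua] := jet_cvg_cvg ju; have /cvg_ex[b vb] := jet_cvg_cvg jv.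
  by apply/cvg_ex; exists (g a b); exact: fg.
have /cvg_ex[a ua] := jet_cvg_cvg ju; have /cvg_ex[b vb] := jet_cvg_cvg jv.
split=> [|j]; first by apply/cvg_ex; exists (g a b); exact: fg.
have -> : (fun i => D3 j (f (u i) (v i))) =
    (fun i => s1 *: f (D1 j (u i)) (v i) + s2 *: f (u i) (D2 j (v i))).
  by apply/funext => i; rewrite f_leibniz.
have S1D i : S1 (D1 j (u i)) by apply: (df_in H1).
have S2D i : S2 (D2 j (v i)) by apply: (df_in H2).
have S3S := df_subspace H3.
apply: (jet_cvgD H3); try by move=> i; apply: (subspaceZ S3S); exact: f_in.
- apply: (jet_cvgZ H3); first by move=> i; exact: f_in.
  by apply: IH => //; [exact: ju.2|exact: jet_cvgS].
- apply: (jet_cvgZ H3); first by move=> i; exact: f_in.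
  by apply: IH => //; [exact: jet_cvgS|exact: jv.2].
Qed.

(** Applied to the products of the algebras, to the two actions and to the two inner
products; the signs [s1] and [s2] account for the latter, whose derivatives are
skew. *)
Lemma completion_leibniz n x y : completion S1 D1 n x -> completion S2 D2 n y ->
  completion S3 D3 n (g x y).
Proof.
move=> /(completionP H1) [u [Su uJ ux]] /(completionP H2) [v [Sv vJ vy]].
apply/(completionP H3); exists (fun i => f (u i) (v i)); split.
- by move=> i; exact: f_in.
- by move=> m mn; apply: jet_cvg_leibniz => //; [exact: uJ|exact: vJ].
- exact: fg.
Qed.

End Leibniz.

Lemma completion_adj (A : cstarAlgType R) (S : set A) (D : 'I_d -> A -> A) n a :
  derivation_family S D -> (forall x, S x -> S (adj x)) ->
  (forall j x, S x -> D j (adj x) = - adj (D j x)) ->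
  completion S D n a -> completion S D n (adj a).
Proof.
move=> HD S_adj D_adj /(completionP HD) [u [Su uJ ua]].
apply/(completionP HD); exists (fun i => adj (u i)); split; last exact: seq_lim_adj.
  by move=> i; exact: S_adj.
move=> m /uJ; elim: m u Su {uJ ua} => [|m IH] u Su ju.
  have /cvg_ex[b ub] := jet_cvg_cvg ju.
  by split=> //; apply/cvg_ex; exists (adj b); exact: seq_lim_adj.
have /cvg_ex[b ub] := jet_cvg_cvg ju.
split=> [|j]; first by apply/cvg_ex; exists (adj b); exact: seq_lim_adj.
have -> : (fun i => D j (adj (u i))) = (fun i => (-1) *: adj (D j (u i))).
  by apply/funext => i; rewrite D_adj // scaleN1r.
have SD i : S (D j (u i)) by apply: (df_in HD).
by apply: (jet_cvgZ HD) => [i|]; [exact: S_adj|apply: IH => //; exact: ju.2].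
Qed.

End Jets.

(** * Leibniz rules for the actions and the left inner product *)

Section ConnectionLeibniz.
Context {R : realType} {A B : cstarAlgType R} {E : completeNormedModType R[i]} {d : nat}.
Context {SA : set A} {SB : set B} {X : set E}.
Context {lact : A -> E -> E} {ract : E -> B -> E}.
Context {lip : E -> E -> A} {rip : E -> E -> B}.
Context {DL : 'I_d -> A -> A} {DR : 'I_d -> B -> B} {nabla : 'I_d -> E -> E}.
Hypothesis EH : hilbert_module ract rip.
Hypothesis XM : pre_morita SA SB X lact ract lip rip.
Hypothesis DLd : commuting_star_derivations SA DL.
Hypothesis DRd : commuting_star_derivations SB DR.
Hypothesis NC : commuting_connections SA SB X lact ract rip DL DR nabla.
Let EM := EH.1.
Let XL := pm_left XM.
Let XR := pm_right XM.
Let XS := rim_subspace XR.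
Let SAS := dss_subspace (pm_subalgA XM).
Let SBS := dss_subspace (pm_subalgB XM).
Let SAM := dss_mul (pm_subalgA XM).
Let SBM := dss_mul (pm_subalgB XM).

Lemma DL_family : derivation_family SA DL.
Proof. by split; [|exact: der_in DLd|exact: der_linear DLd|exact: der_comm DLd]. Qed.

Lemma DR_family : derivation_family SB DR.
Proof. by split; [|exact: der_in DRd|exact: der_linear DRd|exact: der_comm DRd]. Qed.

Lemma nabla_family : derivation_family X nabla.
Proof. by split; [|exact: conn_in NC|exact: conn_linear NC|exact: conn_comm NC]. Qed.

Lemma ractN e b : ract (- e) b = - ract e b.
Proof. by rewrite -scaleN1r (ractZl EM) // scaleN1r. Qed.

Lemma lactN a e : SA a -> X e -> lact a (- e) = - lact a e.
Proof. by move=> Sa Xe; rewrite -scaleN1r (lactZr XL) // scaleN1r. Qed.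

Lemma lactNl a e : SA a -> X e -> lact (- a) e = - lact a e.
Proof. by move=> Sa Xe; rewrite -scaleN1r (lactZl XL) // scaleN1r. Qed.

(** The simultaneous actions from both sides separate the bimodule: if a z b = 0 for
all a and b, insert b = (a z|a z), then a = (z|z).  This makes up for the absence of
units, since the Leibniz rule of a connection is only given for a e b. *)
Lemma biaction_eq x y : X x -> X y ->
  (forall a b, SA a -> SB b -> ract (lact a x) b = ract (lact a y) b) -> x = y.
Proof.
move=> Xx Xy xy; apply/eqP; rewrite -subr_eq0; apply/eqP.
set z := x - y; have Xz : X z by exact: subspaceB.
have z0 a b : SA a -> SB b -> ract (lact a z) b = 0.
  move=> Sa Sb; rewrite (lactDr XL) // ?lactN //; last exact: subspaceN.
  by rewrite (ractDl EM) // ractN xy // subrr.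
have az a : SA a -> lact a z = 0.
  move=> Sa; have Xaz : X (lact a z) by exact: (lact_in XL).
  by apply: (ract_rip_eq0 EH); apply: z0 => //; exact: (rip_in XR).
by apply: (ract_rip_eq0 EH); rewrite -(pm_compat XM) // az //; exact: (lip_in XL).
Qed.

(** The left multiplication by [a] kills all inner products (g|h), hence by fullness
all of [A], in particular a^*. *)
Lemma left_action_faithful a : SA a -> (forall g, X g -> lact a g = 0) -> a = 0.
Proof.
move=> Sa a0; have [u Su ua] := dense_seq (adj a) (pm_full_left XM).
rewrite -[a]adjK; suff -> : adj a = 0 by exact: adj0.
apply: cstar_eq0; rewrite adjK.
apply: (seq_lim_eq (seq_limM (cvg_cst a) ua) (cvg_cst 0)) => i.
have [m [c [s [hs ->]]]] := Su i.
elim/big_rec: _ => [|l x _ x0]; first by rewrite cmulr0.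
have [g [h [Xg Xh sgh]]] := hs l.
rewrite cmulDr x0 addr0 cmulZr sgh -(lip_act XL) // a0 //.
rewrite -(scale0r (0 : E)) (lipZl XL) ?scale0r ?scaler0 //; exact: subspace0.
Qed.

(** Compare the derivatives of a' (a e) b and of (a' a) e b. *)
Lemma nabla_lact j a e : SA a -> X e ->
  nabla j (lact a e) = lact (DL j a) e + lact a (nabla j e).
Proof.
move=> Sa Xe.
have DLin x : SA x -> SA (DL j x) by exact: (der_in DLd).
have Nin x : X x -> X (nabla j x) by exact: (conn_in NC).
have Lin x y : SA x -> X y -> X (lact x y) by exact: (lact_in XL).
have X1 := Lin _ _ (DLin _ Sa) Xe; have X2 := Lin _ _ Sa (Nin _ Xe).
apply: biaction_eq => [| |a' b Sa' Sb]; [by apply: Nin; exact: Lin|exact: subspaceD|].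
have := conn_leibniz NC j Sa' (Lin _ _ Sa Xe) Sb.
rewrite -(lactM XL) // (conn_leibniz NC) //; last exact: SAM.
move=> /addIr; rewrite (der_leibniz DLd) // (lactDl XL) //; try exact: SAM; try exact: DLin.
2: by apply: SAM => //; exact: DLin.
2: by apply: SAM => //; exact: DLin.
rewrite !(lactM XL) //; try exact: DLin; try exact: Nin.
rewrite (ractDl EM) // -addrA => /addrI <-.
by rewrite (lactDr XL) // (ractDl EM).
Qed.

(** Compare the derivatives of a (e b) b' and of (a e) (b b'). *)
Lemma nabla_ract j e b : X e -> SB b ->
  nabla j (ract e b) = ract (nabla j e) b + ract e (DR j b).
Proof.
move=> Xe Sb.
have DRin x : SB x -> SB (DR j x) by exact: (der_in DRd).
have DLin x : SA x -> SA (DL j x) by exact: (der_in DLd).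
have Nin x : X x -> X (nabla j x) by exact: (conn_in NC).
have Rin x y : X x -> SB y -> X (ract x y) by exact: (ract_in XR).
have X1 := Rin _ _ (Nin _ Xe) Sb; have X2 := Rin _ _ Xe (DRin _ Sb).
apply: biaction_eq => [| |a b' Sa Sb']; [by apply: Nin; exact: Rin|exact: subspaceD|].
have := conn_leibniz NC j Sa (Rin _ _ Xe Sb) Sb'.
rewrite -(pm_assoc XM) // -(ractM EM) // (conn_leibniz NC) //; last exact: SBM.
rewrite (der_leibniz DRd) // (ractDr EM) // !(ractM EM) //.
rewrite -(pm_assoc XM) //; last exact: DLin.
rewrite -!addrA => /addrI; rewrite addrA => /addIr <-.
by rewrite (lactDr XL) // (ractDl EM) // -!(pm_assoc XM) //; [exact: DRin|exact: Nin].
Qed.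

(** The derivation on the left algebra is determined by the connection: differentiate
(e|f) g = e (f|g), where the inner product on the right is metric, and use that the left
action is faithful. *)
Lemma DL_lip j e f : X e -> X f ->
  DL j (lip e f) = lip (nabla j e) f - lip e (nabla j f).
Proof.
move=> Xe Xf.
have Nin x : X x -> X (nabla j x) by exact: (conn_in NC).
have Pin x y : X x -> X y -> SA (lip x y) by exact: (lip_in XL).
have DLin x : SA x -> SA (DL j x) by exact: (der_in DLd).
have S1 := DLin _ (Pin _ _ Xe Xf).
have S2 := Pin _ _ (Nin _ Xe) Xf; have S3 := Pin _ _ Xe (Nin _ Xf).
have S23 : SA (lip (nabla j e) f - lip e (nabla j f)) by exact: subspaceB.
apply/eqP; rewrite -subr_eq0; apply/eqP; apply: left_action_faithful.
  exact: subspaceB.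
move=> g Xg; rewrite (lactDl XL) //; last exact: subspaceN.
rewrite lactNl // (lactDl XL) //; last exact: subspaceN.
rewrite lactNl //; apply/eqP; rewrite subr_eq0; apply/eqP.
have Ef := nabla_lact j (Pin _ _ Xe Xf) Xg.
rewrite (pm_compat XM) // nabla_ract // in Ef; last exact: (rip_in XR).
rewrite (conn_metric NC) // (ractDr EM) // in Ef.
rewrite -[- rip _ _]scaleN1r (ractZr EM) // scaleN1r in Ef.
rewrite -!(pm_compat XM) // in Ef; try exact: Nin.
by move: Ef; rewrite addrCA addrC => /addIr.
Qed.

End ConnectionLeibniz.

(** * The completed bimodules *)

(** All identities and inequalities of a Morita context are inherited by smaller
sets; only closure and density need an argument. *)
Lemma pre_morita_restrict (R : realType) (A B : cstarAlgType R) (E : lmodType R[i])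
    (SA TA : set A) (SB TB : set B) (X Y : set E)
    (lact : A -> E -> E) (ract : E -> B -> E) (lip : E -> E -> A) (rip : E -> E -> B) :
  pre_morita TA TB Y lact ract lip rip ->
  SA `<=` TA -> SB `<=` TB -> X `<=` Y ->
  dense_star_subalgebra SA -> dense_star_subalgebra SB -> subspace X ->
  (forall a e, SA a -> X e -> X (lact a e)) ->
  (forall e b, X e -> SB b -> X (ract e b)) ->
  (forall e f, X e -> X f -> SA (lip e f)) ->
  (forall e f, X e -> X f -> SB (rip e f)) ->
  dense (lspan [set a | exists e f, [/\ X e, X f & a = lip e f]]) ->
  dense (lspan [set b | exists e f, [/\ X e, X f & b = rip e f]]) ->
  pre_morita SA SB X lact ract lip rip.
Proof.
move=> M sA sB sX dA dB XS Lin Rin Pin Qin fL fR.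
have L := pm_left M; have Rr := pm_right M.
split=> //.
- split=> //.
  + by move=> a b e /sA ? /sA ? /sX ?; apply: (lactDl L).
  + by move=> a e f /sA ? /sX ? /sX ?; apply: (lactDr L).
  + by move=> z a e /sA ? /sX ?; apply: (lactZl L).
  + by move=> z a e /sA ? /sX ?; apply: (lactZr L).
  + by move=> a b e /sA ? /sA ? /sX ?; apply: (lactM L).
  + by move=> e f g /sX ? /sX ? /sX ?; apply: (lipDl L).
  + by move=> z e f /sX ? /sX ?; apply: (lipZl L).
  + by move=> e f /sX ? /sX ?; apply: (lip_adj L).
  + by move=> a e f /sA ? /sX ? /sX ?; apply: (lip_act L).
  + by move=> e /sX ?; apply: (lip_pos L).
  + by move=> e /sX ?; apply: (lip_def L).
- split=> //.
  + by move=> e f b /sX ? /sX ? /sB ?; apply: (ractDl Rr).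
  + by move=> e b c /sX ? /sB ? /sB ?; apply: (ractDr Rr).
  + by move=> z e b /sX ? /sB ?; apply: (ractZl Rr).
  + by move=> z e b /sX ? /sB ?; apply: (ractZr Rr).
  + by move=> e b c /sX ? /sB ? /sB ?; apply: (ractM Rr).
  + by move=> e f g /sX ? /sX ? /sX ?; apply: (ripDr Rr).
  + by move=> z e f /sX ? /sX ?; apply: (ripZr Rr).
  + by move=> e f /sX ? /sX ?; apply: (rip_adj Rr).
  + by move=> e f b /sX ? /sX ? /sB ?; apply: (rip_act Rr).
  + by move=> e /sX ?; apply: (rip_pos Rr).
  + by move=> e /sX ?; apply: (rip_def Rr).
- by move=> a e b /sA ? /sX ? /sB ?; apply: (pm_assoc M).
- by move=> e b /sX ? /sB ?; apply: (pm_bound_left M).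
- by move=> a e /sA ? /sX ?; apply: (pm_bound_right M).
- by move=> e f g /sX ? /sX ? /sX ?; apply: (pm_compat M).
Qed.

Lemma completion_dense_star (R : realType) (A : cstarAlgType R) (d : nat) (S : set A)
    (D : 'I_d -> A -> A) (n : option nat) :
  dense_star_subalgebra S -> commuting_star_derivations S D ->
  dense_star_subalgebra (completion S D n).
Proof.
move=> HS HD.
have F : derivation_family S D.
  by split; [exact: dss_subspace HS|exact: der_in HD|exact: der_linear HD|exact: der_comm HD].
split.
- exact: completion_subspace.
- have M := bounded_biadditive_cvg (cmul_bounded A).
  move=> a b; apply: (completion_leibniz (s1 := 1) (s2 := 1) F F F (dss_mul HS)).
    by move=> j x y Sx Sy; rewrite !scale1r (der_leibniz HD).
  by move=> x y u v _ _; exact: M.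
- by move=> a; apply: (completion_adj F (dss_adj HS)); exact: der_adj HD.
- by apply: dense_mono (dss_dense HS); exact: (completion_sub F).
Qed.

(** Each derivative of a sequence that represents an element of the completion
converges in [E], so that no term of the sum is infinite; whatever the map [j] is,
the terms are then norms of vectors. *)
Lemma state_seminorm_lty (R : realType) (E H : completeNormedModType R[i]) (d : nat)
    (X : set E) (nabla : 'I_d -> E -> E) (j : E -> H) (n : option nat) e u k :
  derivation_family X nabla -> represents X nabla n u e -> le_order k n ->
  (state_seminorm nabla j k u < +oo)%E.
Proof.
move=> HN [Xu uC _] kn; apply: lte_sum_pinfty => alpha ak.
have /(seminorm_cauchyP HN n Xu) /(_ k kn) /jet_cvg_words := uC.
move=> /(_ (index_word alpha)); rewrite size_index_word => /(_ ak).
under eq_fun do rewrite -mpower_word.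
by move=> uc; case: asboolP => // _; rewrite ltry.
Qed.

Theorem proposition2p13 (R : realType) (A B : cstarAlgType R)
    (E : completeNormedModType R[i]) (d : nat)
    (SA : set A) (SB : set B) (X : set E)
    (lact : A -> E -> E) (ract : E -> B -> E)
    (lip : E -> E -> A) (rip : E -> E -> B)
    (DL : 'I_d -> A -> A) (DR : 'I_d -> B -> B) (nabla : 'I_d -> E -> E)
    (E_hilbert : hilbert_module ract rip)
    (X_dense : dense X)
    (X_morita : pre_morita SA SB X lact ract lip rip)
    (DL_der : commuting_star_derivations SA DL)
    (DR_der : commuting_star_derivations SB DR)
    (nabla_conn : commuting_connections SA SB X lact ract rip DL DR nabla)
    (n : option nat) :
  (exists (lact_n : A -> E -> E) (lip_n : E -> E -> A),
     [/\ forall a e u v, represents SA DL n u a -> represents X nabla n v e ->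
           (fun i => lact (u i) (v i)) @ \oo --> lact_n a e,
         forall e f u v, represents X nabla n u e -> represents X nabla n v f ->
           (fun i => lip (u i) (v i)) @ \oo --> lip_n e f &
         pre_morita (completion SA DL n) (completion SB DR n)
           (completion X nabla n) lact_n ract lip_n rip]) /\
  (forall (oneB : B), is_unit_elt oneB ->
   forall (omega : B -> R[i]), is_state oneB omega ->
   forall (H : completeNormedModType R[i]) (ip : H -> H -> R[i]) (j : E -> H),
     state_completion rip omega ip j ->
   forall (e : E) (u : nat -> E), represents X nabla n u e ->
   forall k : nat, le_order k n ->
     (state_seminorm nabla j k u < +oo)%E).
Proof.
have FX := nabla_family X_morita nabla_conn.
have FA := DL_family X_morita DL_der; have FB := DR_family X_morita DR_der.
split; last first.
  by move=> ? _ ? _ H ip j _ e u ue k; exact: state_seminorm_lty FX ue.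
have [L [P [HL HP M]]] := total_morita E_hilbert X_dense X_morita.
exists L, P; split.
- by move=> a e u v [Su _ ua] [Xv _ ve]; exact: HL.
- by move=> e f u v [Xu _ ue] [Xv _ vf]; exact: HP.
have XL := pm_left X_morita; have XR := pm_right X_morita.
have XX : X `<=` completion X nabla n by exact: completion_sub.
apply: (pre_morita_restrict M) => //.
- exact: completion_dense_star (pm_subalgA X_morita) DL_der.
- exact: completion_dense_star (pm_subalgB X_morita) DR_der.
- exact: completion_subspace.
- move=> a e; apply: (completion_leibniz (s1 := 1) (s2 := 1) FA FX FX (lact_in XL) _ HL).
  by move=> j x y Sx Xy; rewrite !scale1r (nabla_lact E_hilbert X_morita DL_der nabla_conn).
- move=> e b; apply: (completion_leibniz (s1 := 1) (s2 := 1) FX FB FX (ract_in XR)).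
    move=> j x y Sx Xy; rewrite !scale1r.
    exact: (nabla_ract E_hilbert X_morita DL_der DR_der nabla_conn).
  by move=> x y u v _ _; exact: (seq_lim_ract E_hilbert).
- move=> e f; apply: (completion_leibniz (s1 := 1) (s2 := -1) FX FX FA (lip_in XL) _ HP).
  move=> j x y Xx Xy; rewrite scale1r scaleN1r.
  exact: (DL_lip E_hilbert X_morita DL_der DR_der nabla_conn).
- move=> e f; apply: (completion_leibniz (s1 := -1) (s2 := 1) FX FX FB (rip_in XR)).
    by move=> j x y Xx Xy; rewrite scale1r scaleN1r (conn_metric nabla_conn) // addrC.
  by move=> x y u v _ _; exact: (seq_lim_rip E_hilbert).
- apply: dense_mono (pm_full_left X_morita); apply: lspan_mono => _ [e [f [Xe Xf ->]]].
  by exists e, f; split; [exact: XX|exact: XX|rewrite (extends_eq HP)].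
- apply: dense_mono (pm_full_right X_morita); apply: lspan_mono => _ [e [f [Xe Xf ->]]].
  by exists e, f; split; [exact: XX|exact: XX|].
Qed.
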